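(* Let $x(t)=y(t)+\epsilon_t$, $t\in\mathbb{N}$, with $y(t)=\sum_{n=1}^N\alpha_n e^{-i\lambda_n t}$, where $N\in\{0,1,2,\dots\}$, the frequencies $\lambda_n\in[-\pi,\pi)$ are distinct, $\alpha_n\in\mathbb{C}\setminus\{0\}$, and $(\epsilon_t)_{t\ge1}$ are independent complex random variables on a complete probability space $(\Omega,\mathcal{A},\Pr)$. Let $\mu=\sum_{n=1}^N\alpha_n\delta(z-e^{i\lambda_n})$, so that $\operatorname{supp}\mu=\{e^{i\lambda_n}\}_{n=1}^N$ (empty if $N=0$). Let the summation matrix $A$, the sequences $(H_m),(h_m),(J_m)$, and the random sets $\widehat L_m$ be as described in the context. Assume that at least one of the following conditions is fulfilled: (N1) the $\epsilon_t$ are i.i.d. with $\mathbb{E}(\epsilon_t)=0$ and $\mathbb{E}(|\epsilon_t|\log|\epsilon_t|)<\infty$ for all $t$; (N2) the $\epsilon_t$ are i.i.d. symmetric and satisfy $\mathbb{E}\left(|\epsilon_t|\log\log(|\epsilon_t|+e)\right)<\infty$; (N3) the $\epsilon_t$ are independent, symmetric, and have finite variances $\mathbb{E}(|\epsilon_t|^2)$ satisfying $\mathbb{E}(|\epsilon_t|^2)=O(t^\nu)$ as $t\to+\infty$ for a certain $\nu<1$. Then almost surely the sets $\widehat L_m$ converge to $\operatorname{supp}\mu$ as $m\to+\infty$, and $\operatorname{supp}\mu\subset\widehat L_m$ for all $m$ large enough.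
   Context: A complex random variable is symmetric if it has the same distribution as its negative. $\mathbb{T}=\{z\in\mathbb{C}:|z|=1\}$, and $\operatorname{Arc}[\theta_1,\theta_2]=\{e^{i\theta}:\theta_1\le\theta\le\theta_2\}$ for real $\theta_1\le\theta_2$. Summation matrix: $A=(a_{m,t})_{m,t=1}^\infty$ is a fixed real matrix such that: $0<a_{m,1}\le1$ and $a_{m,t}$ is non-increasing in $t$ for every $m\in\mathbb{N}$; $a_{m,t}\ge0$ if $t\le m$ and $a_{m,t}=0$ if $t>m$; $a_{m,t}\to1$ as $m\to+\infty$ for every $t\in\mathbb{N}$; $a_{m,t}$ is non-decreasing in $m$ for every $t\in\mathbb{N}$. For a complex sequence $u=(u(t))_{t\ge1}$ put $S^A_{u,m}(e^{i\theta})=\sum_{t=1}^m a_{m,t}\frac{u(t)}{t}e^{it\theta}$. Let $\mathbf{1}$ denote the sequence identically equal to $1$, so $S^A_{\mathbf{1},m}(e^{i\theta})=\sum_{t=1}^m\frac{a_{m,t}}{t}e^{it\theta}$. Sequences: $(H_m)_{m\ge1}$ are real numbers with $H_m<S^A_{\mathbf{1},m}(1)$ for all $m$ and $\lim H_m=+\infty$; $(h_m)_{m\ge1}$ are real numbers with $\lim h_m=\lim H_m/h_m=+\infty$; $(J_m)_{m\ge1}$ are natural numbers with $|S^A_{\mathbf{1},m}(e^{i\theta})|\ge H_m$ for all $\theta\in[-2\pi/J_m,2\pi/J_m]$. Superlevel arcs: for $h\in\mathbb{R}$ and $J\in\mathbb{N}$, an $(h,J)$-arc for $S^A_{u,m}$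 is a closed arc $\operatorname{Arc}[2\pi j_1/J,2\pi j_2/J]$ with $j_1,j_2\in\mathbb{Z}$, $j_1\le j_2$, such that $|S^A_{u,m}(\exp(i2\pi j/J))|\ge h$ for all $j\in\mathbb{Z}\cap[j_1,j_2]$. $\widehat L_m=\widehat L_m(\omega)$ is the union of all $(h_m,J_m)$-arcs for $S^A_{x,m}$ (the empty set if there are none). Set convergence: for $z\in\mathbb{C}$, $G\subset\mathbb{C}$, $\operatorname{dist}(z,G)=\inf_{\zeta\in G}|z-\zeta|$ if $G\ne\varnothing$ and $\operatorname{dist}(z,\varnothing)=+\infty$; $\operatorname{dist}_{\mathrm{PH}}(G_1,G_2)=\sup_{z\in\mathbb{C}}|\operatorname{dist}(z,G_1)-\operatorname{dist}(z,G_2)|$ if $G_1\cup G_2\ne\varnothing$ (so it is $+\infty$ when exactly one of the sets is empty), and $\operatorname{dist}_{\mathrm{PH}}(\varnothing,\varnothing)=0$. For nonempty closed sets this is the Pompeiu–Hausdorff distance. A sequence of closed subsets $L_m\subset\mathbb{T}$ converges to a closed set $G$ if $\operatorname{dist}_{\mathrm{PH}}(L_m,G)\to0$. *)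

(* Defs.v *)
From HB Require Import structures.
From mathcomp Require Import all_boot all_order all_algebra finmap.
From mathcomp Require Import all_classical all_reals all_analysis.
From mathcomp Require Export complex.

Set Implicit Arguments.
Unset Strict Implicit.
Unset Printing Implicit Defensive.

Import Order.TTheory GRing.Theory Num.Theory.
Import numFieldNormedType.Exports.
Import Normc.
Local Open Scope classical_set_scope.
Local Open Scope ring_scope.

(* The Borel sigma-algebra of the complex plane, transported from R * R along
   the bijection (a, b) |-> a + i b. *)
Section complex_borel.
Variable R : realType.

Definition complex_of_pair (p : R * R) : R[i] := Complex p.1 p.2.

Definition complex_measurable (B : set R[i]) : Prop :=
  measurable (complex_of_pair @^-1` B).

Lemma complex_measurable0 : complex_measurable set0.
Proof. by rewrite /complex_measurable preimage_set0. Qed.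

Lemma complex_measurableC (B : set R[i]) :
  complex_measurable B -> complex_measurable (~` B).
Proof. by rewrite /complex_measurable preimage_setC => mB; exact: measurableC. Qed.

Lemma complex_measurable_bigcup (F : (set R[i])^nat) :
  (forall i, complex_measurable (F i)) -> complex_measurable (\bigcup_i F i).
Proof.
by move=> mF; rewrite /complex_measurable preimage_bigcup; exact: bigcupT_measurable.
Qed.

HB.instance Definition _ := isPointed.Build R[i] 0.
HB.instance Definition _ := isMeasurable.Build default_measure_display R[i]
  complex_measurable0 complex_measurableC complex_measurable_bigcup.

End complex_borel.

(* In all the definitions below the sequences and matrices of the text, whose
   indices start at 1, are functions on nat whose values at 0 are irrelevant. *)

Section probability_notions.
Context (R : realType) (d : measure_display) (T : measurableType d).
Variable P : probability T R.

Definition mutually_independent (eps : nat -> {RV P >-> R[i]}) : Prop :=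
  forall (I : {fset nat}) (B : nat -> set R[i]),
    (forall t, t \in I -> (1 <= t)%N) ->
    (forall t, measurable (B t)) ->
    P (\bigcap_(t in [set` I]) (eps t @^-1` B t)) =
      (\prod_(t <- I) P (eps t @^-1` B t))%E.

Definition identically_distributed (eps : nat -> {RV P >-> R[i]}) : Prop :=
  forall s t, (1 <= s)%N -> (1 <= t)%N ->
    forall B : set R[i], measurable B ->
      distribution P (eps s) B = distribution P (eps t) B.

Definition symmetric_RV (X : {RV P >-> R[i]}) : Prop :=
  forall B : set R[i], measurable B ->
    P (X @^-1` B) = P ((fun w => - X w) @^-1` B).

Definition centered (X : {RV P >-> R[i]}) : Prop :=
  [/\ P.-integrable [set: T] (fun w => (complex.Re (X w))%:E),
      P.-integrable [set: T] (fun w => (complex.Im (X w))%:E),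
      'E_P[fun w => complex.Re (X w)]%E = 0%E &
      'E_P[fun w => complex.Im (X w)]%E = 0%E].

(* [ln 0 = 0] in the library, so the integrand vanishes where [eps t] does. *)
Definition noise_N1 (eps : nat -> {RV P >-> R[i]}) : Prop :=
  mutually_independent eps /\ identically_distributed eps /\
  forall t, (1 <= t)%N ->
    centered (eps t) /\
    ('E_P[fun w => (normc (eps t w) * ln (normc (eps t w)))%R] < +oo)%E.

Definition noise_N2 (eps : nat -> {RV P >-> R[i]}) : Prop :=
  mutually_independent eps /\ identically_distributed eps /\
  forall t, (1 <= t)%N ->
    symmetric_RV (eps t) /\
    ('E_P[fun w => (normc (eps t w) * ln (ln (normc (eps t w) + expR 1)))%R]
      < +oo)%E.

Definition noise_N3 (eps : nat -> {RV P >-> R[i]}) : Prop :=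
  let second_moment t := 'E_P[fun w => (normc (eps t w) ^+ 2)%R]%E in
  mutually_independent eps /\
  (forall t, (1 <= t)%N ->
     symmetric_RV (eps t) /\ (second_moment t < +oo)%E) /\
  exists nu : R, nu < 1 /\
    (fun t : nat => fine (second_moment t) : R^o) =O_\oo
      (fun t : nat => t%:R `^ nu : R^o).

End probability_notions.

Section summation.
Variable R : realType.
Implicit Types (a : nat -> nat -> R) (u : nat -> R[i]) (theta h : R) (J m : nat).

Definition expi theta : R[i] := Complex (cos theta) (sin theta).

Definition Arc (theta1 theta2 : R) : set R[i] :=
  [set expi theta | theta in `[theta1, theta2]].

Definition summation_matrix a : Prop :=
  (forall m, (1 <= m)%N -> 0 < a m 1%N <= 1) /\
  (forall m s t, (1 <= m)%N -> (1 <= s)%N -> (s <= t)%N -> a m t <= a m s) /\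
  (forall m t, (1 <= m)%N -> (1 <= t)%N -> (t <= m)%N -> 0 <= a m t) /\
  (forall m t, (1 <= m)%N -> (m < t)%N -> a m t = 0) /\
  (forall t, (1 <= t)%N -> a m t @[m --> \oo] --> (1 : R)) /\
  (forall l m t, (1 <= l)%N -> (l <= m)%N -> (1 <= t)%N -> a l t <= a m t).

Definition SA a u m (z : R[i]) : R[i] :=
  \sum_(1 <= t < m.+1) (a m t)%:C%C * (u t / t%:R) * z ^+ t.

Definition ones : nat -> R[i] := fun=> 1.

Definition grid J (j : int) : R := 2 * pi * j%:~R / J%:R.

Definition superlevel_arc a u m h J (K : set R[i]) : Prop :=
  exists j1 j2 : int, j1 <= j2 /\
    (forall j : int, j1 <= j <= j2 -> h <= normc (SA a u m (expi (grid J j)))) /\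
    K = Arc (grid J j1) (grid J j2).

Definition superlevel_arcs_union a u m h J : set R[i] :=
  \bigcup_(K in superlevel_arc a u m h J) K.

End summation.

Section set_convergence.
Variable R : realType.
Local Open Scope ereal_scope.

(* [ereal_inf set0 = +oo]. *)
Definition dist (z : R[i]) (G : set R[i]) : \bar R :=
  ereal_inf [set (normc (z - zeta)%R)%:E | zeta in G].

(* The case distinction is needed since [+oo - +oo = -oo] in [\bar R]. *)
Definition dist_PH (G1 G2 : set R[i]) : \bar R :=
  if G1 `|` G2 == set0 then 0
  else ereal_sup [set `|dist z G1 - dist z G2| | z in [set: R[i]]].

Definition set_converges (L : nat -> set R[i]) (G : set R[i]) : Prop :=
  dist_PH (L m) G @[m --> \oo] --> 0.

End set_convergence.

Section measures.
Variable R : realType.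

Definition supp (mu : set R[i] -> R[i]) : set R[i] :=
  [set z | forall r : R, 0 < r ->
    exists B : set R[i], measurable B /\
      B `<=` [set w | normc (w - z) < r] /\ mu B != 0].

Definition spectral_measure N (alpha : 'I_N -> R[i]) (lambda : 'I_N -> R)
    (B : set R[i]) : R[i] :=
  \sum_(n < N) alpha n * \1_B (expi (lambda n)).

Definition signal N (alpha : 'I_N -> R[i]) (lambda : 'I_N -> R) (t : nat) : R[i] :=
  \sum_(n < N) alpha n * expi (- (lambda n * t%:R)).

End measures.

(* Main.v *)
Require Import Defs.
From HB Require Import structures.
From mathcomp Require Import all_boot all_order all_algebra finmap.
From mathcomp Require Import all_classical all_reals all_analysis.
From mathcomp Require Import measurable_realfun.
From mathcomp Require Import zify ring lra.

Set Implicit Arguments.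
Unset Strict Implicit.
Unset Printing Implicit Defensive.

Import Order.TTheory GRing.Theory Num.Theory.
Import numFieldNormedType.Exports.
Import Normc.
Local Open Scope classical_set_scope.
Local Open Scope ring_scope.

(** Write S_m(z) for the partial sum of eps_t z^t / t over t <= m.  The theorem
    rests on one fact about the noise: almost surely S_m is bounded on the
    closed unit disc, uniformly in m ([ae_noise_bounded]).

    Given such a bound, the rest is deterministic.  The rows of the summation
    matrix are non-increasing, so summation by parts transfers the bound to the
    matrix sums of the noise ([SA_bounded]) and gives 2 / |1 - z| as a bound for
    the kernel, the matrix sum of the constant sequence 1 ([SA_ones_decay]).
    The matrix sum of the observed sequence is a combination of kernels rotated
    to the atoms e^(i lambda_n), plus the noise.  It is therefore bounded at a
    positive distance from the atoms, and at least |alpha_n| H_m - O(1) at the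
    two grid points that surround e^(i lambda_n).  As h_m and H_m / h_m tend to
    infinity, the grid points of the superlevel arcs end up close to the atoms
    ([arcs_near_atoms]), and every atom ends up in an arc ([atom_in_arcs]).
    That the grid becomes fine follows from the peak hypothesis itself: the
    kernel is at least H_m on an arc of the width of one step, and at most
    2 / |1 - z|, so that neighbouring grid points are at distance at most
    2 / H_m ([mesh]).

    For the noise, split eps_t at the cutoff t / j^8, where j = level t is the
    number of the dyadic block of t, counted from 1.  Beyond independence, the
    noise conditions enter only through the estimates collected in [tame].

    The part above the cutoff sums absolutely.  Under the second condition this
    is where the double logarithm comes from: a value x lies above the cutoff,
    but below t, only for t between x and x (log x)^8 up to a constant, that is
    on O(log log x) dyadic blocks, and each block contributes at most x to the
    sum of x / t ([sum_large_loglog]); times t < x are finitely many almost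
    surely.  Under the first condition there are O(log x) blocks in all
    ([sum_large_log]), and this also controls the means of the truncated
    variables.  The third condition is a comparison of powers.

    The part below the cutoff has bounded terms and summable variances that are
    so small that an exponential moment of parameter j^4 / 2 on the j-th block
    has a bounded quadratic term ([block_exp_moment]).  The resulting gain
    exp(- j^2) absorbs a union over all ends m of the block and all points of a
    net of the disc of size polynomial in 2^j, so the suprema of the block sums
    are O(j^-2) up to the means, hence summable ([ae_truncated_bounded]).  The
    almost sure statements come from one principle: nonnegative functions whose
    integrals have bounded partial sums have bounded partial sums almost
    everywhere ([ae_bounded_sums]). *)

Lemma eqW (disp : Order.disp_t) (U : porderType disp) (x y : U) : x = y -> (x <= y)%O.
Proof. by move=> ->. Qed.

Lemma ler_sum_term (R : realType) (I : finType) (F : I -> R) (i : I) :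
  (forall k, 0 <= F k) -> F i <= \sum_k F k.
Proof. by move=> F0; rewrite (bigD1 i)//= lerDl sumr_ge0. Qed.

(** * Series with bounded partial sums *)

Section bounded_partial_sums.
Context (R : realType).
Implicit Types f g : nat -> R.

Definition bounded_sums (f : nat -> R) := exists M, forall n, \sum_(i < n) f i <= M.

Lemma bounded_sums_le f g : (forall i, f i <= g i) ->
  bounded_sums g -> bounded_sums f.
Proof.
by move=> fg [M gM]; exists M => n; rewrite (le_trans _ (gM n))// ler_sum.
Qed.

Lemma bounded_sumsD f g : bounded_sums f -> bounded_sums g ->
  bounded_sums (fun i => f i + g i).
Proof.
by move=> [M fM] [M' gM]; exists (M + M') => n; rewrite big_split/=;
  apply: lerD; [exact: fM|exact: gM].
Qed.

Lemma bounded_sumsZ c f : 0 <= c -> bounded_sums f ->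
  bounded_sums (fun i => c * f i).
Proof.
by move=> c0 [M fM]; exists (c * M) => n; rewrite -mulr_sumr ler_wpM2l.
Qed.

Lemma sum_dyadic_blocks (V : nmodType) (f : nat -> V) n :
  \sum_(1 <= t < 2 ^ n) f t = \sum_(j < n) \sum_(2 ^ j <= t < 2 ^ j.+1) f t.
Proof.
elim: n => [|n ih]; first by rewrite big_ord0 expn0 big_geq.
rewrite big_ord_recr/= -ih [LHS](big_cat_nat (n := 2 ^ n))//= ?expn_gt0//.
by rewrite leq_exp2l.
Qed.

Lemma bounded_sums_dyadic f : bounded_sums (fun t => f t.+1) ->
  bounded_sums (fun j => \sum_(2 ^ j <= t < 2 ^ j.+1) f t).
Proof.
move=> [M fM]; exists M => n; rewrite -sum_dyadic_blocks.
have := fM (2 ^ n).-1; rewrite -(big_mkord xpredT (fun t => f t.+1)).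
by rewrite -(@big_add1 _ _ _ 0 (2 ^ n) xpredT f).
Qed.

Lemma sum_le_dyadic f (b : nat -> R) n : (forall t, 0 <= f t) ->
  (forall j, \sum_(2 ^ j <= t < 2 ^ j.+1) f t <= b j) ->
  \sum_(1 <= t < n) f t <= \sum_(j < n) b j.
Proof.
move=> f0 fb; apply: (@le_trans _ _ (\sum_(1 <= t < 2 ^ n) f t)).
  case: n => [|n]; first by rewrite !big_geq.
  rewrite [leRHS](big_cat_nat (n := n.+1))//=; last by rewrite ltnW// ltn_expl.
  by rewrite lerDl sumr_ge0.
by rewrite sum_dyadic_blocks ler_sum.
Qed.

Lemma bounded_sums_geometric : bounded_sums (fun i => (2^-1 : R) ^+ i).
Proof.
exists 2 => n; rewrite (_ : \sum_(i < n) _ = 2 - 2 * 2^-1 ^+ n).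
  by rewrite gerBl mulr_ge0// exprn_ge0.
elim: n => [|n ih]; first by rewrite big_ord0 expr0 mulr1 subrr.
by rewrite big_ord_recr/= ih exprS; field.
Qed.

Lemma bounded_sums_inv_sqr : bounded_sums (fun i => (i.+1%:R ^+ 2)^-1 : R).
Proof.
exists 2 => n; suff : \sum_(i < n) (i.+1%:R ^+ 2)^-1 <= 2 - n%:R^-1 :> R.
  by move=> /le_trans; apply; rewrite gerBl invr_ge0.
elim: n => [|n ih]; first by rewrite big_ord0 invr0 subr0.
case: n ih => [_|n ih].
  by rewrite big_ord1 (_ : 1%:R = 1 :> R)// expr1n invr1; lra.
rewrite big_ord_recr/=; apply: (le_trans (lerD ih (lexx _))).
rewrite -addrA lerD2l -lerBrDl opprK addrC.
rewrite -[n.+2%:R]natr1; set x : R := n.+1%:R.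
have x0 : 0 < x by rewrite /x ltr0n.
rewrite -subr_ge0 (_ : _ - _ = (x * (x + 1) ^+ 2)^-1).
  by rewrite invr_ge0 mulr_ge0 ?sqr_ge0// ltW.
field; rewrite !gt_eqF//; lra.
Qed.

(** Capping the terms at 1 does not affect convergence: bounded partial sums of
    the capped terms force all but finitely many terms below the cap.  Together
    with [ae_bounded_sums] this does the work of the Borel-Cantelli lemma. *)
Lemma bounded_sums_min1 f : (forall i, 0 <= f i) ->
  bounded_sums (fun i => Num.min (f i) 1) -> bounded_sums f.
Proof.
move=> f0 bg; have [M gM] := bg.
have g0 i : 0 <= Num.min (f i) 1 by rewrite le_min f0 ler01.
have : series (fun i => Num.min (f i) 1) @ \oo -->
    limn (series (fun i => Num.min (f i) 1)).
  apply: nondecreasing_is_cvgn.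
    by apply/nondecreasing_seqP => n; rewrite !seriesEnat/= big_nat_recr//= lerDl.
  by exists M => _ [n _ <-]; rewrite /series/= big_mkord; exact: gM.
move=> /cvgP /cvg_series_cvg_0 /cvgr_lt /(_ 1 ltr01) [n0 _ hn0].
have : bounded_sums (fun i => if (i < n0)%N then f i else 0).
  exists (\sum_(i < n0) f i) => n.
  rewrite -(big_mkord xpredT (fun i => if (i < n0)%N then f i else 0)) -big_mkcond/=.
  rewrite -(big_mkord xpredT f).
  have [nn0|nn0] := leqP n n0.
    rewrite [leRHS](big_cat_nat (n := n))//= -[leLHS]addr0 lerD ?sumr_ge0//.
    by rewrite [leLHS]big_mkcond/= ler_sum// => i _; case: ifP.
  rewrite [leLHS](big_cat_nat (n := n0))//= ?(ltnW nn0)// [X in _ + X]big_nat_cond.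
  rewrite [X in _ + X]big1 ?addr0.
    by rewrite [leLHS]big_mkcond/= ler_sum// => i _; case: ifP.
  by move=> i /andP[/andP[h _]]; rewrite ltnNge h.
move=> /(bounded_sumsD bg); apply: bounded_sums_le => i.
case: ltnP => i0; first by rewrite lerDr.
by have := hn0 i i0; rewrite /= gt_min ltxx orbF => /ltW fi1; rewrite addr0 le_min lexx.
Qed.

End bounded_partial_sums.

Section ae_summability.
Context (R : realType) (d : measure_display) (T : measurableType d).
Context (P : probability T R).

(** The integral of the full series is finite by monotone convergence, so the
    series is finite almost everywhere. *)
Lemma ae_bounded_sums (f : nat -> T -> R) (M : R) :
  (forall i, measurable_fun setT (f i)) -> (forall i w, 0 <= f i w) ->
  (forall n, \sum_(i < n) \int[P]_w (f i w)%:E <= M%:E)%E ->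
  {ae P, forall w, bounded_sums (fun i => f i w)}.
Proof.
move=> mf f0 fM.
have mfE i : measurable_fun setT (fun w => (f i w)%:E) by exact/measurable_EFinP.
have f0E i w : (0 <= (f i w)%:E)%E by rewrite lee_fin.
pose F w := (\sum_(0 <= i <oo) (f i w)%:E)%E.
have F0 w : (0 <= F w)%E by exact: nneseries_ge0.
have mF : measurable_fun setT F.
  by apply: (ge0_emeasurable_sum (P := xpredT)).
have iF : P.-integrable setT F.
  apply/integrableP; split => //.
  under eq_integral do rewrite gee0_abs//.
  rewrite integral_nneseries//.
  apply: (@le_lt_trans _ _ M%:E); last exact: ltry.
  apply: lime_le.
    by apply: is_cvg_ereal_nneg_natsum => i _; exact: integral_ge0.
  by apply: nearW => n; rewrite big_mkord.
have := integrable_ae measurableT iF.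
apply: filterS => w /(_ I) Ffin; exists (fine (F w)) => n.
rewrite -lee_fin fineK// -sumEFin -(big_mkord xpredT (fun i => (f i w)%:E)).
exact: nneseries_lim_ge.
Qed.

End ae_summability.

(** * Products of functions of independent variables *)

Section independence.
Context (R : realType) (d : measure_display) (T : measurableType d).
Variable P : probability T R.
Local Open Scope ereal_scope.

Import HBNNSimple.

(** If the factorisation holds when the function of X is an indicator, then it
    holds for simple functions by linearity and in general by monotone
    convergence. *)
Lemma integral_factor d' (T' : measurableType d') (X : {mfun T >-> T'})
    (Y : T -> R) (c : R) (g : T' -> R) :
  measurable_fun setT Y -> (forall w, 0 <= Y w)%R ->
  measurable_fun setT g -> (forall x, 0 <= g x)%R ->
  (forall B, measurable B ->
    \int[P]_w (\1_B (X w) * Y w)%:E = P (X @^-1` B) * c%:E) ->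
  \int[P]_w (g (X w) * Y w)%:E = \int[P]_w (g (X w))%:E * c%:E.
Proof.
move=> mY Y0 mg g0 indic.
have mX : measurable_fun setT X by exact: measurable_funPT.
have mEg : measurable_fun setT (EFin \o g) by exact/measurable_EFinP.
pose f n : {nnsfun T' >-> R} := nnsfun_approx measurableT mEg n.
have fcvg x : (f n x)%:E @[n --> \oo] --> (g x)%:E.
  by apply: (cvg_nnsfun_approx measurableT mEg) => // y _; rewrite lee_fin.
have fnd x : {homo (fun n => f n x) : m n / (m <= n)%N >-> (m <= n)%R}.
  by move=> m n mn; exact/lefP/nd_nnsfun_approx.
have mfX n : measurable_fun setT (fun w => f n (X w)).
  by apply: measurableT_comp.
have simple n : \int[P]_w (f n (X w) * Y w)%:E =
    \int[P]_w (f n (X w))%:E * c%:E.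
  have mB k : measurable (f n @^-1` [set k]).
    by rewrite -[_ @^-1` _]setTI; apply: measurable_funP.
  have mBX k : measurable (X @^-1` (f n @^-1` [set k])).
    by rewrite -[_ @^-1` _]setTI; exact: mX.
  have m1 k : measurable_fun setT (fun w => (\1_(f n @^-1` [set k]) (X w) : R)).
    by apply: (measurableT_comp _ mX); exact: measurable_indic.
  have lhs : \int[P]_w (f n (X w) * Y w)%:E = \sum_(k \in range (f n))
      (k%:E * (P (X @^-1` (f n @^-1` [set k])) * c%:E)).
    transitivity (\int[P]_w (\sum_(k \in range (f n))
        ((k * \1_(f n @^-1` [set k]) (X w))%:E * (Y w)%:E))).
      apply: eq_integral => w _.
      rewrite EFinM [in LHS]fimfunE -fsumEFin// !fsbig_finite//= ge0_sume_distrl//.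
      by move=> k _; rewrite nnfun_muleindic_ge0.
    rewrite ge0_integral_fsum//.
    - apply: eq_fsbigr => k /[!inE] -[x _ fxk].
      rewrite -indic//.
      under eq_integral do rewrite -EFinM -mulrA EFinM.
      rewrite ge0_integralZl//.
      + by apply/measurable_EFinP/measurable_funM.
      + by move=> w _; rewrite lee_fin mulr_ge0.
      + by rewrite lee_fin -fxk.
    - move=> k; apply: emeasurable_funM => //; apply/measurable_EFinP => //.
      by apply: measurable_funM.
    - by move=> k w _; rewrite mule_ge0 ?nnfun_muleindic_ge0 ?lee_fin.
  rewrite lhs.
  have -> : \int[P]_w (f n (X w))%:E = \sum_(k \in range (f n))
      (k%:E * (P (X @^-1` (f n @^-1` [set k])))).
    transitivity (\int[P]_w (\sum_(k \in range (f n))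
          ((k * \1_(f n @^-1` [set k]) (X w))%:E))).
      apply: eq_integral => w _.
      by rewrite [in LHS]fimfunE -fsumEFin.
    rewrite ge0_integral_fsum//.
    - apply: eq_fsbigr => k /[!inE] -[x _ fxk].
      under eq_integral do rewrite EFinM.
      rewrite ge0_integralZl//.
      + congr (_ * _); rewrite -[in RHS](setIT (X @^-1` _)) -integral_indic//.
      + exact/measurable_EFinP.
      + by rewrite lee_fin -fxk.
    - by move=> k; apply/measurable_EFinP; apply: measurable_funM.
    - by move=> k w _; rewrite nnfun_muleindic_ge0.
  rewrite !fsbig_finite//= ge0_sume_distrl.
    by apply: eq_bigr => k _; rewrite muleA.
  move=> k _; have [k0|k0] := ltP k 0%R; last by rewrite mule_ge0.
  by rewrite preimage_nnfun0// preimage_set0 measure0 mule0.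
have lim1 : \int[P]_w (f n (X w) * Y w)%:E @[n --> \oo] -->
    \int[P]_w (g (X w) * Y w)%:E.
  rewrite [X in _ --> X](_ : _ = \int[P]_w limn (fun n => (f n (X w) * Y w)%:E)).
    apply: cvg_monotone_convergence => //.
    - by move=> n; apply/measurable_EFinP/measurable_funM.
    - by move=> n w _; rewrite lee_fin mulr_ge0.
    - by move=> w _ m n mn; rewrite lee_fin ler_wpM2r// fnd.
  apply: eq_integral => w _; apply/esym/cvg_lim => //.
  under eq_fun do rewrite EFinM; rewrite EFinM.
  exact: cvgeZr.
have lim2 : \int[P]_w (f n (X w))%:E * c%:E @[n --> \oo] -->
    \int[P]_w ((g (X w))%:E) * c%:E.
  apply: cvgeZr => //.
  rewrite [X in _ --> X](_ : _ = \int[P]_w limn (fun n => (f n (X w))%:E)).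
    apply: cvg_monotone_convergence => //.
    - by move=> n; exact/measurable_EFinP.
    - by move=> n w _; rewrite lee_fin.
    - by move=> w _ m n mn; rewrite lee_fin fnd.
  by apply: eq_integral => w _; apply/esym/cvg_lim.
move: lim1; under eq_fun do rewrite simple; move=> lim1.
by rewrite -(cvg_lim _ lim1)// (cvg_lim _ lim2).
Qed.

(** Independence is given for events only.  The indicators are replaced by
    functions one variable at a time, which is why the statement mixes both:
    with the other factors fixed, [integral_factor] handles one replacement. *)
Lemma integral_prod_indep_indic (eps : nat -> {RV P >-> R[i]})
    (g : nat -> R[i] -> R) (e : nat -> R) (s1 s2 : seq nat) (B : nat -> set R[i]) :
  mutually_independent eps -> uniq (s1 ++ s2) ->
  (forall t, t \in s1 ++ s2 -> (1 <= t)%N) ->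
  (forall t, measurable_fun setT (g t)) -> (forall t x, (0 <= g t x)%R) ->
  (forall t, t \in s1 -> \int[P]_w (g t (eps t w))%:E = (e t)%:E) ->
  (forall t, measurable (B t)) ->
  \int[P]_w ((\prod_(t <- s1) g t (eps t w)) *
      \prod_(t <- s2) \1_(B t) (eps t w))%:E =
  (\prod_(t <- s1) (e t)%:E) * \prod_(t <- s2) P (eps t @^-1` B t).
Proof.
move=> indep us ge1 mg g0 ge.
have meps t : measurable_fun setT (eps t) by exact: measurable_funPT.
elim: s1 s2 B us ge1 ge => [|t s1 ih] s2 B us ge1 ge mB.
  rewrite big_nil mul1e.
  have mcap : measurable (\bigcap_(t in [set` [fset t in s2]%fset]) (eps t @^-1` B t)).
    apply: fin_bigcap_measurable => // t _.
    by rewrite -[_ @^-1` _]setTI; exact: meps.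
  transitivity (P (\bigcap_(t in [set` [fset t in s2]%fset]) (eps t @^-1` B t))).
    rewrite -[in RHS](setIT (\bigcap_(_ in _) _)) -integral_indic//.
    apply: eq_integral => w _; congr EFin.
    rewrite big_nil mul1r [RHS]indicE.
    case: (pselect ((\bigcap_(t in [set` [fset t in s2]%fset]) (eps t @^-1` B t)) w)) => h.
      rewrite mem_set// big_seq big1// => t ts; rewrite indicE mem_set//.
      by apply: (h t); rewrite /= inE.
    rewrite memNset//.
    have [t ts tB] : exists2 t, t \in s2 & ~ B t (eps t w).
      apply: contrapT => nex; apply: h => t /=; rewrite inE => ts.
      by apply: contrapT => nB; apply: nex; exists t.
    by rewrite (big_rem t ts)/= indicE memNset// mul0r.
  rewrite indep//; last by move=> t; rewrite inE; exact: ge1.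
  rewrite (perm_big s2)//=.
  apply: uniq_perm; [exact: fset_uniq|by []|].
  by move=> t; rewrite inE.
have ts1 : t \notin s1 ++ s2 by move: us => /= /andP[].
have us' : uniq (s1 ++ s2) by move: us => /= /andP[].
rewrite big_cons -muleA -ge ?mem_head//.
set c := (X in _ = _ * X).
have cfin : c \is a fin_num.
  rewrite /c fin_numM//; first by rewrite prodEFin.
  apply: prode_fin_num => u _; apply: fin_num_measure.
  by rewrite -[_ @^-1` _]setTI; exact: meps.
have mgeps u : measurable_fun setT (fun w => g u (eps u w)).
  exact: measurableT_comp.
have mBeps u : measurable_fun setT (fun w => \1_(B u) (eps u w) : R).
  by apply: measurableT_comp => //; exact: measurable_indic.
under eq_integral do rewrite big_cons -mulrA.
rewrite -(fineK cfin); apply: integral_factor => //.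
- by apply: measurable_funM; exact: measurable_prod.
- by move=> w; rewrite mulr_ge0 ?prodr_ge0.
move=> D mD; rewrite (fineK cfin).
have neqt u : u \in s1 ++ s2 -> (u == t) = false.
  by move=> us12; apply/eqP => ut; rewrite -ut us12 in ts1.
transitivity ((\prod_(t <- s1) (e t)%:E) *
   \prod_(u <- t :: s2) P (eps u @^-1` (if u == t then D else B u))).
  rewrite -ih//.
  - apply: eq_integral => w _; congr EFin; rewrite big_cons eqxx mulrCA.
    congr (_ * (_ * _))%R; apply: eq_big_seq => u us2.
    by rewrite neqt// mem_cat us2 orbT.
  - by rewrite uniq_catC /= -[X in _ && X]uniq_catC us' mem_cat orbC -mem_cat ts1.
  - move=> u; rewrite mem_cat inE orbCA -mem_cat => h; apply: ge1.
    by rewrite cat_cons inE.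
  - by move=> u us1; apply: ge; rewrite inE us1 orbT.
  - by move=> u; case: ifP.
rewrite big_cons eqxx muleCA /c; congr (_ * (_ * _)).
apply: eq_big_seq => u us2.
by rewrite neqt// mem_cat us2 orbT.
Qed.

Lemma integral_prod_indep (eps : nat -> {RV P >-> R[i]})
    (g : nat -> R[i] -> R) (e : nat -> R) (s : seq nat) :
  mutually_independent eps -> uniq s -> (forall t, t \in s -> (1 <= t)%N) ->
  (forall t, measurable_fun setT (g t)) -> (forall t x, (0 <= g t x)%R) ->
  (forall t, t \in s -> \int[P]_w (g t (eps t w))%:E = (e t)%:E) ->
  \int[P]_w (\prod_(t <- s) g t (eps t w))%:E = (\prod_(t <- s) e t)%:E.
Proof.
move=> indep us ge1 mg g0 ge.
have := @integral_prod_indep_indic eps g e s [::] (fun=> setT) indep.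
rewrite cats0 => /(_ us ge1 mg g0 ge (fun=> measurableT)).
rewrite big_nil mule1 -prodEFin => <-.
by apply: eq_integral => w _; rewrite big_nil mulr1.
Qed.

End independence.

(** * Exponential moments of independent sums *)

Section exponential_moments.
Context (R : realType).

(** Multiply by 1 - x and use exp (- x) >= 1 - x. *)
Lemma expR_le_quadratic (x : R) : x <= 2^-1 -> expR x <= 1 + x + 2 * x ^+ 2.
Proof.
move=> x2; have := expR_ge1Dx (- x); rewrite expRN => ex.
have ex0 := expR_gt0 x.
have : (1 - x) * expR x <= 1 by rewrite -ler_pdivlMr// div1r.
have : 1 <= (1 - x) * (1 + x + 2 * x ^+ 2).
  have : 0 <= x ^+ 2 * (1 - 2 * x) by rewrite mulr_ge0 ?sqr_ge0//; lra.
  by rewrite (_ : (1 - x) * (1 + x + 2 * x ^+ 2) = 1 + x ^+ 2 * (1 - 2 * x)) ?lerDl//; ring.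
move=> h1 h2; have := le_trans h2 h1; rewrite ler_pM2l//; lra.
Qed.

Context (d : measure_display) (T : measurableType d) (P : probability T R).

Lemma bounded_integrable (Y : T -> R) (b : R) : measurable_fun setT Y ->
  (forall w, `|Y w| <= b) -> P.-integrable setT (EFin \o Y).
Proof.
move=> mY Yb; apply: (@le_integrable _ _ _ _ _ measurableT _ (EFin \o cst b)).
- exact/measurable_EFinP.
- by move=> w _ /=; rewrite lee_fin (le_trans (Yb w))// ler_norm.
- exact: finite_measure_integrable_cst.
Qed.

(** The variables need not be centred: a small mean only contributes the linear
    term l * e to the exponent. *)
Lemma mgf_bound (Y : T -> R) (b l e v : R) : measurable_fun setT Y ->
  (forall w, `|Y w| <= b) -> 0 <= l -> l * b <= 2^-1 ->
  (\int[P]_w (Y w)%:E <= e%:E)%E -> (\int[P]_w (Y w ^+ 2)%:E <= v%:E)%E ->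
  exists2 E : R, (\int[P]_w (expR (l * Y w))%:E = E%:E)%E &
    0 <= E <= expR (l * e + 2 * l ^+ 2 * v).
Proof.
move=> mY Yb l0 lb Ye Yv.
have iY : P.-integrable setT (EFin \o Y) by exact: bounded_integrable mY Yb.
have mY2 : measurable_fun setT (fun w => Y w ^+ 2) by exact: measurable_funX.
have iY2 : P.-integrable setT (EFin \o (fun w => Y w ^+ 2)).
  apply: (bounded_integrable (b := b ^+ 2)) => // w.
  by rewrite normrX lerXn2r// ?nnegrE// (le_trans _ (Yb w)).
have lY w : l * Y w <= 2^-1.
  by apply: le_trans lb; rewrite ler_wpM2l// (le_trans (ler_norm _) (Yb w)).
have mX : measurable_fun setT (fun w => expR (l * Y w)).
  by apply: measurableT_comp => //; exact: measurable_funM.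
have iX : P.-integrable setT (fun w => (expR (l * Y w))%:E).
  apply: (bounded_integrable (b := expR 2^-1)) => // w.
  by rewrite ger0_norm ?expR_ge0// ler_expR.
have i1 : P.-integrable setT (fun=> 1%:E) by exact: finite_measure_integrable_cst.
have ilY : P.-integrable setT (fun w => l%:E * (Y w)%:E)%E by exact: integrableZl.
have ilY2 : P.-integrable setT (fun w => (2 * l ^+ 2)%:E * (Y w ^+ 2)%:E)%E.
  exact: (integrableZl _ _ iY2).
exists (fine (\int[P]_w (expR (l * Y w))%:E)).
  by rewrite fineK//; exact: integrable_fin_num.
rewrite -!lee_fin fineK; last exact: integrable_fin_num.
apply/andP; split; first by apply: integral_ge0 => w _; rewrite lee_fin expR_ge0.
apply: (@le_trans _ _ (\int[P]_w ((1%:E + l%:E * (Y w)%:E) +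
    (2 * l ^+ 2)%:E * (Y w ^+ 2)%:E))%E).
  apply: le_integral => //.
    by apply: integrableD => //; apply: integrableD.
  move=> w _; rewrite -!EFinM -!EFinD lee_fin.
  apply: (le_trans (expR_le_quadratic (lY w))).
  by rewrite exprMn mulrA.
rewrite integralD//; last by apply: integrableD.
rewrite integralD// integralZl// integralZl//.
rewrite integral_cst// [X in (_ * X)%E]probability_setT mule1.
apply: (@le_trans _ _ (1 + (l * e + 2 * l ^+ 2 * v))%:E); last first.
  by rewrite lee_fin expR_ge1Dx.
rewrite addrA !EFinD !EFinM leeD//.
  by rewrite leeD// lee_wpmul2l.
by rewrite lee_wpmul2l// lee_fin mulr_ge0// sqr_ge0.
Qed.

(** Exponential moments multiply by independence, and the bounds of [mgf_bound]
    for single terms add up in the exponent. *)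
Lemma bernstein (eps : nat -> {RV P >-> R[i]}) (y : nat -> R[i] -> R)
    (s : seq nat) (l u : R) (b e v : nat -> R) :
  mutually_independent eps -> uniq s -> (forall t, t \in s -> (1 <= t)%N) ->
  (forall t, measurable_fun setT (y t)) -> 0 <= l ->
  (forall t x, t \in s -> `|y t x| <= b t) ->
  (forall t, t \in s -> l * b t <= 2^-1) ->
  (forall t, t \in s -> (\int[P]_w (y t (eps t w))%:E <= (e t)%:E)%E) ->
  (forall t, t \in s -> (\int[P]_w (y t (eps t w) ^+ 2)%:E <= (v t)%:E)%E) ->
  (\int[P]_w (expR (l * (\sum_(t <- s) y t (eps t w) - u)))%:E <=
   (expR (l * \sum_(t <- s) e t + 2 * l ^+ 2 * (\sum_(t <- s) v t) - l * u))%:E)%E.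
Proof.
move=> indep us s1 my l0 yb lb ye yv.
have my' t : measurable_fun setT (fun w => y t (eps t w)).
  by apply: measurableT_comp => //; exact: measurable_funPT.
have HE t : exists E, t \in s ->
    (\int[P]_w (expR (l * y t (eps t w)))%:E)%E = E%:E /\
    0 <= E <= expR (l * e t + 2 * l ^+ 2 * v t).
  have [ts|] := boolP (t \in s); last by exists 0.
  have [E h1 h2] := mgf_bound (my' t) (fun w => yb t _ ts) l0 (lb t ts) (ye t ts) (yv t ts).
  by exists E.
have [E HE'] := choice HE.
have -> : (\int[P]_w (expR (l * (\sum_(t <- s) y t (eps t w) - u)))%:E)%E =
    (\int[P]_w ((expR (- (l * u)))%:E * (\prod_(t <- s) expR (l * y t (eps t w)))%:E))%E.
  apply: eq_integral => w _; rewrite mulrBr expRD EFinM muleC mulr_sumr.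
  by rewrite expR_sum.
rewrite ge0_integralZl//; last 2 first.
- apply/measurable_EFinP; apply: measurable_prod => t _.
  by apply: measurableT_comp => //; apply: measurable_funM.
- by move=> w _; rewrite lee_fin prodr_ge0// => t _; exact: expR_ge0.
rewrite (integral_prod_indep (g := fun t x => expR (l * y t x)) (e := E))//.
- rewrite -EFinM lee_fin addrC expRD ler_pM2l ?expR_gt0//.
  rewrite !mulr_sumr -big_split expR_sum /=.
  rewrite big_seq [leRHS]big_seq; apply: ler_prod => t ts.
  by have [] := HE' t ts.
- by move=> t; apply: measurableT_comp => //; apply: measurable_funM.
- by move=> t ts; have [] := HE' t ts.
Qed.

End exponential_moments.

(** * Complex numbers and the unit disc *)

Section complex_facts.
Context (R : realType).
Implicit Types (x y z : R[i]).

Lemma normc_ge0 x : 0 <= normc x.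
Proof. by case: x => a b; exact: sqrtr_ge0. Qed.

Lemma normc_sum (I : Type) (s : seq I) (Q : pred I) (F : I -> R[i]) :
  normc (\sum_(i <- s | Q i) F i) <= \sum_(i <- s | Q i) normc (F i).
Proof.
elim/big_rec2: _ => [|i u v _ h]; first by rewrite normc0.
by rewrite (le_trans (le_normcD _ _))// lerD2l.
Qed.

Lemma normcX x n : normc (x ^+ n) = normc x ^+ n.
Proof.
by elim: n => [|n ih]; rewrite ?expr0 ?normc1// !exprS normcM ih.
Qed.

Lemma normc_real (r : R) : normc (r%:C)%C = `|r|.
Proof. by rewrite /= expr0n/= addr0 sqrtr_sqr. Qed.

Lemma normc_nat n : normc (n%:R : R[i]) = n%:R.
Proof. by rewrite -(rmorph_nat (real_complex R)) normc_real ger0_norm. Qed.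

Lemma normcB x y : normc (x - y) = normc (y - x).
Proof. by rewrite -normcN opprB. Qed.

Lemma ler_normcB x y : normc x - normc y <= normc (x - y).
Proof. by rewrite lerBlDr (le_trans _ (le_normcD _ _))// subrK. Qed.

Lemma ReD x y : complex.Re (x + y) = complex.Re x + complex.Re y.
Proof. by case: x y => [a b] [c e]. Qed.

Lemma Re_sum (I : Type) (s : seq I) (Q : pred I) (F : I -> R[i]) :
  complex.Re (\sum_(i <- s | Q i) F i) = \sum_(i <- s | Q i) complex.Re (F i).
Proof. by apply: (big_morph (fun x => complex.Re x) ReD). Qed.

Lemma ReM x y : complex.Re (x * y) =
  complex.Re x * complex.Re y - complex.Im x * complex.Im y.
Proof. by case: x y => [a b] [c e]. Qed.

Lemma ReMr (r : R) x : complex.Re ((r%:C)%C * x) = r * complex.Re x.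
Proof. by rewrite ReM/= mul0r subr0. Qed.

Lemma normc_ge_Re x : `|complex.Re x| <= normc x.
Proof. by case: x => a b /=; rewrite -sqrtr_sqr ler_wsqrtr// lerDl sqr_ge0. Qed.

Lemma normc_ge_Im x : `|complex.Im x| <= normc x.
Proof. by case: x => a b /=; rewrite -sqrtr_sqr ler_wsqrtr// lerDr sqr_ge0. Qed.

Lemma normc_le_ReIm x : normc x <= `|complex.Re x| + `|complex.Im x|.
Proof.
case: x => a b /=; rewrite -[leRHS]ger0_norm ?addr_ge0// -sqrtr_sqr.
apply: ler_wsqrtr; rewrite sqrrD !real_normK ?num_real// -addrA [_ *+ 2 + _]addrC.
by rewrite addrA lerDl mulrn_wge0// mulr_ge0.
Qed.

Lemma normc_expB (z z' : R[i]) n : normc z <= 1 -> normc z' <= 1 ->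
  normc (z ^+ n - z' ^+ n) <= n%:R * normc (z - z').
Proof.
move=> z1 z'1; rewrite subrXX normcM mulrC ler_wpM2r ?normc_ge0//.
rewrite (le_trans (normc_sum _ _ _))// (le_trans (ler_sum _ (G := fun=> 1) _))//.
  move=> i _; rewrite normcM !normcX mulr_ile1 ?exprn_ge0 ?normc_ge0//;
    by rewrite exprn_ile1 ?normc_ge0.
by rewrite sumr_const card_ord.
Qed.

(** The four powers of the imaginary unit: one-sided bounds on the real part in
    these directions bound the norm. *)
Definition direction (r : 'I_4) : R[i] := ('i%C) ^+ r.

Lemma normc_direction r : normc (direction r) = 1.
Proof. by rewrite /direction normcX /= expr0n/= add0r expr1n sqrtr1 expr1n. Qed.

Lemma normc_le_directions x b :
  (forall r, complex.Re (direction r * x) <= b) -> normc x <= 2 * b.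
Proof.
move=> h; apply: (le_trans (normc_le_ReIm x)); rewrite mulr2n mulrDl !mul1r.
have h0 := h (@Ordinal 4 0 isT); have h1 := h (@Ordinal 4 1 isT).
have h2 := h (@Ordinal 4 2 isT); have h3 := h (@Ordinal 4 3 isT).
move: h0 h1 h2 h3; rewrite /direction !exprS !expr0.
case: x {h} => p q /= h0 h1 h2 h3.
by apply: lerD; rewrite ler_norml; apply/andP; split; lra.
Qed.

Lemma measurable_Re : measurable_fun [set: R[i]] (fun x => complex.Re x).
Proof.
move=> _ B mB; rewrite setTI.
have := @measurable_fst _ _ R R measurableT B mB; rewrite setTI.
exact.
Qed.

Lemma measurable_Im : measurable_fun [set: R[i]] (fun x => complex.Im x).
Proof.
move=> _ B mB; rewrite setTI.
have := @measurable_snd _ _ R R measurableT B mB; rewrite setTI.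
exact.
Qed.

Lemma measurable_normc : measurable_fun [set: R[i]] (fun x => normc x).
Proof.
rewrite (_ : (fun x => normc x) =
    (fun x : R[i] => Num.sqrt (complex.Re x ^+ 2 + complex.Im x ^+ 2))).
  apply: measurableT_comp.
    by apply: continuous_measurable_fun; exact: sqrt_continuous.
  by apply: measurable_funD; apply: measurable_funX;
    [exact: measurable_Re|exact: measurable_Im].
by apply/funext => -[a b].
Qed.

Lemma measurable_ReMl (a : R[i]) :
  measurable_fun [set: R[i]] (fun x => complex.Re (a * x)).
Proof.
under eq_fun do rewrite ReM.
by apply: measurable_funB; apply: measurable_funM => //;
  [exact: measurable_Re|exact: measurable_Im].
Qed.

(** Zero above the threshold, rather than clipped to it, so that a value is
    either kept or left entirely to the tail. *)
Definition truncate (tau : R) x := if normc x <= tau then x else 0.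

Lemma normc_truncate tau x : 0 <= tau -> normc (truncate tau x) <= tau.
Proof. by rewrite /truncate; case: ifPn => //; rewrite normc0. Qed.

Lemma measurable_comp_truncate (f : R[i] -> R) tau : measurable_fun setT f ->
  measurable_fun [set: R[i]] (fun x => f (truncate tau x)).
Proof.
move=> mf; rewrite (_ : (fun x => f (truncate tau x)) =
   (fun x => if normc x <= tau then f x else f 0)).
  apply: measurable_fun_ifT => //; apply: measurable_fun_ler => //.
  exact: measurable_normc.
by apply/funext => x; rewrite /truncate; case: ifP.
Qed.

Lemma measurable_Re_truncate (tau : R) (a : R[i]) :
  measurable_fun [set: R[i]] (fun x => complex.Re (a * truncate tau x)).
Proof.
apply: (@measurable_comp_truncate (fun x => complex.Re (a * x))).
exact: measurable_ReMl.
Qed.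

End complex_facts.

Section net.
Context (R : realType).

(** Rounding towards 0, so that the rounded value is no larger in absolute
    value; this keeps rounded points of the disc inside the disc. *)
Lemma grid_approx (Q : nat) (x : R) : (0 < Q)%N -> `|x| <= 1 ->
  exists k : 'I_(2 * Q).+1, let y := (k%:R - Q%:R) / Q%:R : R in
    `|y| <= `|x| /\ `|x - y| <= Q%:R^-1.
Proof.
move=> Q0 x1; have QR : 0 < Q%:R :> R by rewrite ltr0n.
set n := Num.truncn (`|x| * Q%:R).
have xQ0 : 0 <= `|x| * Q%:R by rewrite mulr_ge0.
have n1 : n%:R <= `|x| * Q%:R by rewrite /n truncn_le.
have n2 : `|x| * Q%:R < n.+1%:R by rewrite /n truncnS_gt.
have nQ : (n <= Q)%N.
  by rewrite -(ler_nat R) (le_trans n1)// ler_piMl// ltW.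
have [x0|x0] := leP 0 x.
  have kP : (Q + n < (2 * Q).+1)%N by lia.
  exists (Ordinal kP); rewrite /= natrD addrAC subrr add0r.
  rewrite (ger0_norm x0) in n1 n2 *.
  rewrite ger0_norm; last by rewrite divr_ge0.
  rewrite ler_pdivrMr//; split => //.
  have e : x - n%:R / Q%:R = (x * Q%:R - n%:R) / Q%:R by field; rewrite gt_eqF.
  rewrite e normrM (ger0_norm (x := Q%:R^-1)) ?invr_ge0 ?(ltW QR)//.
  rewrite ler_piMl ?invr_ge0 ?(ltW QR)// ger0_norm; last by rewrite subr_ge0.
  by move: n2; rewrite -natr1; lra.
have kP : (Q - n < (2 * Q).+1)%N by lia.
exists (Ordinal kP); rewrite /= natrB// addrAC subrr add0r.
rewrite (ltr0_norm x0) in n1 n2 *.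
rewrite mulNr normrN ger0_norm; last by rewrite divr_ge0.
rewrite ler_pdivrMr//; split => //.
have e : x - - (n%:R / Q%:R) = (x * Q%:R + n%:R) / Q%:R by field; rewrite gt_eqF.
rewrite e normrM (ger0_norm (x := Q%:R^-1)) ?invr_ge0 ?(ltW QR)//.
rewrite ler_piMl ?invr_ge0 ?(ltW QR)// ler0_norm; last by lra.
by move: n2; rewrite -natr1; lra.
Qed.

(** Grid points outside the disc are replaced by 0: every value of the net then
    lies in the disc, and the net is indexed by a fixed finite type. *)
Definition disc_net (Q : nat) (k : 'I_(2 * Q).+1 * 'I_(2 * Q).+1) : R[i] :=
  let z := Complex ((k.1%:R - Q%:R) / Q%:R) ((k.2%:R - Q%:R) / Q%:R) in
  if normc z <= 1 then z else 0.

Lemma normc_disc_net Q k : normc (@disc_net Q k) <= 1.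
Proof. by rewrite /disc_net; case: ifPn => //; rewrite normc0 ler01. Qed.

Lemma disc_net_approx (Q : nat) (z : R[i]) : (0 < Q)%N -> normc z <= 1 ->
  exists k, normc (z - @disc_net Q k) <= 2 / Q%:R.
Proof.
move=> Q0 z1.
have [k [k1 k2]] := grid_approx Q0 (le_trans (normc_ge_Re z) z1).
have [l [l1 l2]] := grid_approx Q0 (le_trans (normc_ge_Im z) z1).
exists (k, l); rewrite /disc_net /=.
have -> : Num.sqrt (((k%:R - Q%:R) / Q%:R) ^+ 2 + ((l%:R - Q%:R) / Q%:R) ^+ 2)
    <= 1 :> R.
  apply: le_trans z1; case: z k1 l1 {k2 l2} => p q /= k1 l1.
  apply: ler_wsqrtr; rewrite -(real_normK (num_real p)) -(real_normK (num_real q)).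
  by apply: lerD; rewrite -real_normK ?num_real// lerXn2r// nnegrE.
apply: (le_trans (normc_le_ReIm _)); case: z k2 l2 {z1 k1 l1} => p q /= k2 l2.
by rewrite mulr_natl mulr2n lerD.
Qed.

End net.

(** * Dyadic blocks and the truncated noise *)

Section levels.
Context (R : realType).

Definition level (t : nat) := (trunc_log 2 t).+1.
(** The exponent 8 leaves room for the parameter level^4 / 2 in the exponential
    moments: then parameter * bound <= 1/2 and parameter^2 * variance = O(1). *)
Definition cutoff (t : nat) : R := t%:R / (level t)%:R ^+ 8.

Lemma level_block j t : (2 ^ j <= t < 2 ^ j.+1)%N -> level t = j.+1.
Proof. by move=> h; rewrite /level (trunc_log_eq _ h). Qed.

Lemma cutoff_ge0 t : 0 <= cutoff t.
Proof. by rewrite /cutoff divr_ge0// exprn_ge0. Qed.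

Lemma sum_inv_block j : \sum_(2 ^ j <= t < 2 ^ j.+1) t%:R^-1 <= 1 :> R.
Proof.
rewrite big_nat_cond.
apply: (@le_trans _ _ (\sum_(2 ^ j <= t < 2 ^ j.+1) (2 ^ j)%:R^-1)).
  rewrite [leRHS]big_nat_cond; apply: ler_sum => t /andP[/andP[jt _] _].
  by rewrite lef_pV2 ?posrE ?ltr0n ?(leq_trans _ jt) ?expn_gt0// ler_nat.
rewrite sumr_const_nat expnS mul2n -addnn addnK -[_ *+ _]mulr_natr mulVf//.
Qed.

End levels.

Section truncated_noise.
Context (R : realType) (d : measure_display) (T : measurableType d).
Context (P : probability T R) (eps : nat -> {RV P >-> R[i]}).
Context (C : R) (e : nat -> R).

Let X t w := truncate (cutoff R t) (eps t w).

Hypothesis indep : mutually_independent eps.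
Hypothesis C0 : 0 <= C.
Hypothesis e0 : forall t, 0 <= e t.
Hypothesis e_sum : bounded_sums (fun t => e t.+1).
Hypothesis mean_small : forall (t : nat) (a : R[i]), (1 <= t)%N -> normc a <= 1 ->
  (\int[P]_w (complex.Re (a * X t w) / t%:R)%:E <= (e t)%:E)%E.
Hypothesis moment_small : forall t : nat, (1 <= t)%N ->
  (\int[P]_w ((normc (X t w) / t%:R) ^+ 2)%:E <=
   (C / (t%:R * (level t)%:R ^+ 8))%:E)%E.

(* On block j the exponential parameter [lam j] and the threshold [u j] are
   such that lam j * (2 / (j + 1)^2) = (j + 1)^2, while [E j] accounts for the
   means. *)
Let lam j : R := j.+1%:R ^+ 4 / 2.
Let E j := \sum_(2 ^ j <= t < 2 ^ j.+1) e t.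
Let u j : R := 2 / j.+1%:R ^+ 2 + E j.

(** Linear terms: the means over the block sum to at most [E j], which [u j]
    cancels.  Quadratic terms: the variances over the block sum to at most
    C / (j + 1)^8, the inverse of the order of the squared parameter. *)
Lemma block_exp_moment j m (a : nat -> R[i]) : (m < 2 ^ j.+1)%N ->
  (forall t, normc (a t) <= 1) ->
  (\int[P]_w (expR (lam j * (\sum_(2 ^ j <= t < m.+1)
      complex.Re (a t * X t w) / t%:R - u j)))%:E <=
   (expR (C / 2 - j.+1%:R ^+ 2))%:E)%E.
Proof.
move=> mj a1; set s := index_iota (2 ^ j) m.+1.
have ts t : t \in s -> (2 ^ j <= t < 2 ^ j.+1)%N.
  rewrite mem_index_iota => /andP[-> tm]; apply: (leq_trans tm mj).
have t1 t : t \in s -> (1 <= t)%N.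
  by move=> /ts/andP[h _]; rewrite (leq_trans _ h)// expn_gt0.
have j0 : 0 < j.+1%:R :> R by rewrite ltr0n.
have j1 : 1 <= j.+1%:R :> R by rewrite ler1n.
pose y t x := complex.Re (a t * truncate (cutoff R t) x) / t%:R.
have my t : measurable_fun setT (y t).
  apply: measurable_funM => //.
  exact: measurable_Re_truncate.
have yX t w : `|y t w| <= normc (truncate (cutoff R t) w) / t%:R.
  rewrite /y normrM (ger0_norm (x := t%:R^-1)) ?invr_ge0// ler_wpM2r ?invr_ge0//.
  by rewrite (le_trans (normc_ge_Re _))// normcM ler_piMl ?normc_ge0.
have mX t : measurable_fun setT (fun x => normc (truncate (cutoff R t) x)).
  by apply: measurable_comp_truncate; exact: measurable_normc.
apply: (@le_trans _ _ (expR (lam j * \sum_(t <- s) e t + 2 * lam j ^+ 2 *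
   (\sum_(t <- s) C / (t%:R * j.+1%:R ^+ 8)) - lam j * u j))%:E).
  apply: (@bernstein _ _ _ P eps y s (lam j) (u j)
    (fun=> (j.+1%:R ^+ 8)^-1) e (fun t => C / (t%:R * j.+1%:R ^+ 8))) => //.
  - exact: iota_uniq.
  - by rewrite /lam divr_ge0// exprn_ge0// ltW.
  - move=> t x tin; apply: (le_trans (yX t x)).
    rewrite ler_pdivrMr ?ltr0n ?t1// mulrC -(level_block (ts _ tin)).
    exact/normc_truncate/cutoff_ge0.
  - move=> t tin; rewrite /lam (_ : _ / _ / _ = 2^-1 * (j.+1%:R ^+ 4)^-1).
      by rewrite ler_piMr ?invr_ge0// invf_le1 ?exprn_gt0// exprn_ege1.
    by field; rewrite gt_eqF.
  - by move=> t tin; apply: mean_small => //; exact: t1.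
  - move=> t tin; have := moment_small (t1 _ tin).
    rewrite (level_block (ts _ tin)); apply: le_trans.
    have meps : measurable_fun setT (eps t) by exact: measurable_funPT.
    apply: ge0_le_integral => //.
    + by move=> w _; rewrite lee_fin sqr_ge0.
    + by apply/measurable_EFinP/measurable_funX; exact: measurableT_comp.
    + apply/measurable_EFinP/measurable_funX/measurable_funM => //.
      exact: (measurableT_comp (mX t)).
    + move=> w _; rewrite lee_fin -real_normK ?num_real// lerXn2r// ?nnegrE//.
        by rewrite divr_ge0// normc_ge0.
      exact: yX.
rewrite lee_fin ler_expR.
have sub (F : nat -> R) : (forall t, 0 <= F t) ->
    \sum_(t <- s) F t <= \sum_(2 ^ j <= t < 2 ^ j.+1) F t.
  move=> F0; have [h|h] := leqP m.+1 (2 ^ j).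
    by rewrite /s big_geq// sumr_ge0.
  by rewrite [leRHS](big_cat_nat (n := m.+1))//= ?(ltnW h)// lerDl sumr_ge0.
have h1 : lam j * \sum_(t <- s) e t <= lam j * E j.
  by rewrite ler_wpM2l ?sub// /lam divr_ge0// exprn_ge0// ltW.
have h2 : \sum_(t <- s) C / (t%:R * j.+1%:R ^+ 8) <= C / j.+1%:R ^+ 8.
  under eq_bigr do rewrite invfM mulrCA mulrC.
  rewrite -mulr_sumr ler_piMr ?divr_ge0 ?exprn_ge0 ?(ltW j0)//.
  by rewrite (le_trans (sub _ _))// ?sum_inv_block// => t; rewrite invr_ge0.
have h3 : 2 * lam j ^+ 2 * (\sum_(t <- s) C / (t%:R * j.+1%:R ^+ 8)) <= C / 2.
  apply: (@le_trans _ _ (2 * lam j ^+ 2 * (C / j.+1%:R ^+ 8))).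
    by rewrite ler_wpM2l// mulr_ge0// sqr_ge0.
  by rewrite /lam le_eqVlt; apply/orP; left; apply/eqP; field; rewrite gt_eqF.
have h4 : lam j * u j = j.+1%:R ^+ 2 + lam j * E j.
  by rewrite /u mulrDr /lam; congr (_ + _); field; rewrite gt_eqF.
by rewrite h4; lra.
Qed.

(* A block polynomial has degree below 2^(j+1) and at most 2^j coefficients, all
   bounded by 1, so a net of mesh 8^-j determines it up to O(2^-j). *)
Let Q j := (8 ^ j)%N.
Let S j m (k : 'I_(2 * Q j).+1 * 'I_(2 * Q j).+1) (r : 'I_4) (w : T) :=
  \sum_(2 ^ j <= t < m.+1)
    complex.Re (direction R r * disc_net R k ^+ t * X t w) / t%:R.
Let G j w := \sum_(m < 2 ^ j.+1) \sum_k \sum_r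
  expR (lam j * (@S j m k r w - u j)).

Let mS j m k r : measurable_fun setT (@S j m k r).
Proof.
apply: measurable_sum => t; apply: measurable_funM => //.
apply: (@measurableT_comp _ _ _ _ _ _
  (fun x => complex.Re (direction R r * disc_net R k ^+ t * truncate (cutoff R t) x))).
  exact: measurable_Re_truncate.
exact: measurable_funPT.
Qed.

(* The union has at most 72 * 128^j terms, and 256^j exp (- (j + 1)^2) is
   bounded; the remaining factor 2^-j makes the moments summable. *)
Let G_moment j : (\int[P]_w (G j w)%:E <=
  (72 * expR (C / 2 + 16) * (2^-1) ^+ j)%:E)%E.
Proof.
have mG m k r : measurable_fun setT (fun w => (expR (lam j * (@S j m k r w - u j)))%:E).
  apply/measurable_EFinP; apply: measurableT_comp => //.
  by apply: measurable_funM => //; exact: measurable_funB.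
apply: (@le_trans _ _ (\int[P]_w (\sum_(m < 2 ^ j.+1) \sum_k \sum_r
    (expR (lam j * (@S j m k r w - u j)))%:E))%E).
  apply/eqW/eq_integral => w _; rewrite /G -sumEFin; apply: eq_bigr => m _.
  by rewrite -sumEFin; apply: eq_bigr => k _; rewrite -sumEFin.
have pos m k r w : (0 <= (expR (lam j * (@S j m k r w - u j)))%:E)%E.
  by rewrite lee_fin expR_ge0.
rewrite ge0_integral_sum//; last 2 first.
- by move=> m; apply: emeasurable_sum => k; apply: emeasurable_sum => r.
- by move=> m w _; apply: sume_ge0 => k _; apply: sume_ge0.
apply: (@le_trans _ _ (\sum_(m < 2 ^ j.+1) \sum_(k : 'I_(2 * Q j).+1 * 'I_(2 * Q j).+1)
   \sum_(r < 4) (expR (C / 2 - j.+1%:R ^+ 2))%:E)%E).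
  apply: lee_sum => m _; rewrite ge0_integral_sum//; last 2 first.
  - by move=> k; apply: emeasurable_sum => r.
  - by move=> k w _; apply: sume_ge0.
  apply: lee_sum => k _; rewrite ge0_integral_sum//.
  apply: lee_sum => r _; apply: block_exp_moment => // t.
  by rewrite normcM normc_direction mul1r normcX exprn_ile1 ?normc_ge0// normc_disc_net.
rewrite !sumEFin lee_fin !sumr_const card_prod !card_ord -!mulrnA.
rewrite -[_ *+ (4 * _)]mulr_natl mulnA.
have h1 : (4 * ((2 * Q j).+1 * (2 * Q j).+1) * 2 ^ j.+1)%:R <=
    72 * 128 ^+ j :> R.
  rewrite -!natrX -natrM ler_nat.
  apply: (@leq_trans (4 * ((3 * Q j) * (3 * Q j)) * 2 ^ j.+1)).
    rewrite leq_mul2r leq_mul2l leq_mul ?orbT//;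
      by have : (0 < Q j)%N by [rewrite expn_gt0]; lia.
  rewrite expnS (_ : 128 = 8 * 8 * 2)%N// !expnMn /Q; nia.
apply: (le_trans (ler_wpM2r (expR_ge0 _) h1)).
rewrite -!mulrA ler_wpM2l// [C / 2 - _]addrC expRD.
rewrite [C / 2 + _]addrC expRD [leRHS]mulrAC mulrA ler_wpM2r ?expR_ge0//.
rewrite exprVn -ler_pdivrMr ?invr_gt0 ?exprn_gt0// invrK mulrAC -exprMn.
rewrite expRN -ler_pdivlMr ?invr_gt0 ?expR_gt0// invrK -expRD.
apply: (@le_trans _ _ (expR (8 * j%:R))); last first.
  by rewrite ler_expR -natr1; have := sqr_ge0 (j%:R - 3 : R); nra.
rewrite expRM_natr lerXn2r ?nnegrE ?expR_ge0//.
rewrite -[8]mul1r expRM_natr (_ : 128 * 2 = 2 ^+ 8) ?lerXn2r ?nnegrE ?expR_ge0//.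
  by rewrite (le_trans _ (expR_ge1Dx 1)).
by rewrite !exprS expr0; ring.
Qed.

(** Almost surely the sum K of all the exponentials G_j is finite, so each of
    them is at most K.  Hence every block sum at a net point is at most
    u_j + K / lam_j in each direction, which is summable in j. *)
Lemma ae_truncated_bounded : {ae P, forall w, exists B, forall z m,
  normc z <= 1 -> normc (\sum_(1 <= t < m.+1) X t w / t%:R * z ^+ t) <= B}.
Proof.
have mG j : measurable_fun setT (G j).
  apply: measurable_sum => m; apply: measurable_sum => k; apply: measurable_sum => r.
  apply: measurableT_comp => //.
  by apply: measurable_funM => //; exact: measurable_funB.
have G0 j w : 0 <= G j w.
  by apply: sumr_ge0 => m _; apply: sumr_ge0 => k _; apply: sumr_ge0 => r _; exact: expR_ge0.
have [M gM] := bounded_sumsZ (mulr_ge0 (ler0n _ 72) (expR_ge0 (C / 2 + 16)))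
  (bounded_sums_geometric R).
have : {ae P, forall w, bounded_sums (G ^~ w)}.
  apply: (ae_bounded_sums (M := M)) => // n.
  apply: (@le_trans _ _ (\sum_(i < n) (72 * expR (C / 2 + 16) * (2^-1) ^+ i)%:E)%E).
    by apply: lee_sum => i _; exact: G_moment.
  by rewrite sumEFin lee_fin.
apply: filterS => w [K GK].
pose K' := Num.max K 0.
have K'0 : 0 <= K' by rewrite le_max lexx orbT.
have GK' j : G j w <= K'.
  rewrite le_max; apply/orP; left; apply: le_trans (GK j.+1).
  by rewrite big_ord_recr/= lerDr sumr_ge0.
pose beta j := (2 + 2 * K') * (j.+1%:R ^+ 2)^-1 + E j.
have SK j m (mj : (m < 2 ^ j.+1)%N) k r : @S j m k r w <= beta j.
  have j1 : 1 <= j.+1%:R :> R by rewrite ler1n.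
  have : expR (lam j * (@S j m k r w - u j)) <= K'.
    apply: le_trans (GK' j).
    apply: le_trans (@ler_sum_term _ _ _ (Ordinal mj) _) => [|i].
      apply: le_trans (@ler_sum_term _ _ _ k _) => [|i].
        by apply: (@ler_sum_term _ _ (fun r => expR (lam j * (@S j m k r w - u j)))) => i;
          exact: expR_ge0.
      by apply: sumr_ge0 => *; exact: expR_ge0.
    by apply: sumr_ge0 => *; apply: sumr_ge0 => *; exact: expR_ge0.
  (* exp x <= K' gives x <= K', which is enough here and avoids a logarithm. *)
  move=> /(le_trans (expR_ge1Dx _)) h.
  have {h} : lam j * (@S j m k r w - u j) <= K' by move: h; lra.
  rewrite -ler_pdivlMl; last by rewrite /lam divr_gt0// exprn_gt0// ltr0n.
  rewrite lerBlDl => /le_trans; apply; rewrite /beta /u addrAC lerD2r.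
  rewrite [leRHS]mulrDl lerD2l.
  have -> : (lam j)^-1 * K' = 2 * K' / j.+1%:R ^+ 4.
    have : j.+1%:R != 0 :> R by rewrite pnatr_eq0.
    by rewrite /lam; move: (j.+1%:R : R) => x x0; field.
  rewrite ler_wpM2l ?mulr_ge0// lef_pV2 ?posrE ?exprn_gt0 ?ltr0n//.
  by rewrite ler_weXn2l.
have coef t : (1 <= t)%N -> normc (X t w / t%:R) <= 1.
  move=> t1; rewrite normcM normcV normc_nat ler_pdivrMr ?ltr0n// mul1r.
  apply: (le_trans (normc_truncate _ (cutoff_ge0 R t))).
  by rewrite /cutoff ler_piMr// invf_le1 ?exprn_gt0 ?ltr0n// exprn_ege1// ler1n.
have blk j m (mj : (m < 2 ^ j.+1)%N) z : normc z <= 1 ->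
    normc (\sum_(2 ^ j <= t < m.+1) X t w / t%:R * z ^+ t) <=
    2 * beta j + 4 * 2^-1 ^+ j.
  move=> z1; have [k kz] := disc_net_approx (expn_gt0 8 j) z1.
  set y := disc_net R k in kz.
  have -> : \sum_(2 ^ j <= t < m.+1) X t w / t%:R * z ^+ t =
      \sum_(2 ^ j <= t < m.+1) X t w / t%:R * y ^+ t +
      \sum_(2 ^ j <= t < m.+1) X t w / t%:R * (z ^+ t - y ^+ t).
    by rewrite -big_split; apply: eq_bigr => t _; rewrite /= -mulrDr addrC subrK.
  apply: (le_trans (le_normcD _ _)); apply: lerD.
    apply: normc_le_directions => r; rewrite mulr_sumr Re_sum.
    apply: le_trans (SK j m mj k r); rewrite le_eqVlt; apply/orP; left; apply/eqP.
    apply: eq_bigr => t _; rewrite -/y.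
    rewrite (_ : direction R r * _ = ((t%:R^-1 : R)%:C)%C *
      (direction R r * y ^+ t * X t w)); first by rewrite ReMr mulrC.
    rewrite fmorphV/= rmorph_nat; ring.
  apply: (le_trans (normc_sum _ _ _)).
  apply: (@le_trans _ _ (\sum_(2 ^ j <= t < m.+1) (2 ^ j.+1)%:R * (2 / (8 ^ j)%:R))).
    rewrite big_nat_cond [leRHS]big_nat_cond; apply: ler_sum => t /andP[/andP[jt tm] _].
    have t1 : (1 <= t)%N by rewrite (leq_trans _ jt)// expn_gt0.
    rewrite normcM -[leRHS]mul1r ler_pM ?normc_ge0 ?coef//.
    apply: (le_trans (normc_expB t z1 (normc_disc_net R k))).
    rewrite ler_pM ?normc_ge0// ler_nat.
    by rewrite (leq_trans _ mj)// ltnW.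
  rewrite sumr_const_nat.
  apply: (@le_trans _ _ (((2 ^ j.+1)%:R * (2 / (8 ^ j)%:R)) *+ 2 ^ j)).
    apply: ler_wpMn2l; first by rewrite mulr_ge0// divr_ge0.
    by rewrite leq_subLR addnn -mul2n -expnS.
  rewrite -[leLHS]mulr_natr expnS !natrX natrM natrX (_ : 8 = 2 * 2 * 2 :> R); last by ring.
  rewrite !exprMn exprVn le_eqVlt; apply/orP; left; apply/eqP; field.
  by rewrite expf_neq0.
have : bounded_sums (fun j => 2 * beta j + 4 * 2^-1 ^+ j).
  apply: bounded_sumsD; last exact/bounded_sumsZ/bounded_sums_geometric.
  apply: bounded_sumsZ => //; apply: bounded_sumsD; last exact: bounded_sums_dyadic.
  by apply: bounded_sumsZ; [rewrite addr_ge0// mulr_ge0|exact: bounded_sums_inv_sqr].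
move=> [B hB]; exists B => z [_|m z1].
  by rewrite big_geq// normc0; have := hB 0; rewrite big_ord0.
have := hB (trunc_log 2 m.+1).+1; apply: le_trans.
have /andP[jm mj] := trunc_log_bounds (isT : (1 < 2)%N) (ltn0Sn m).
set j := trunc_log 2 m.+1 in jm mj *.
rewrite (big_cat_nat (n := 2 ^ j))/= ?expn_gt0//; last exact: leqW.
apply: (le_trans (le_normcD _ _)); rewrite big_ord_recr/=; apply: lerD; last exact: blk.
rewrite sum_dyadic_blocks; apply: (le_trans (normc_sum _ _ _)).
apply: ler_sum => i _; have i0 : (0 < 2 ^ i.+1)%N by rewrite expn_gt0.
by rewrite -{1}(prednK i0); apply: blk => //; rewrite prednK.
Qed.

End truncated_noise.

(** * Splitting the noise at the cutoff *)

Section tame.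
Context (R : realType) (d : measure_display) (T : measurableType d).
Context (P : probability T R).
Implicit Types (eps : nat -> {RV P >-> R[i]}).

Definition body eps t w := truncate (cutoff R t) (eps t w).
Definition tail eps t w := normc (eps t w - body eps t w) / t%:R.

(** What the noise conditions are needed for: almost vanishing means and small
    second moments below the cutoff, and a summable tail.  The tail is capped at
    1 because the second condition does not give an integrable tail sum. *)
Definition tame eps := exists (C : R) (e : nat -> R) (M : R),
  [/\ 0 <= C, (forall t, 0 <= e t) /\ bounded_sums (fun t => e t.+1),
   forall (t : nat) (a : R[i]), (1 <= t)%N -> normc a <= 1 ->
    (\int[P]_w (complex.Re (a * body eps t w) / t%:R)%:E <= (e t)%:E)%E,
   forall t : nat, (1 <= t)%N ->
    (\int[P]_w ((normc (body eps t w) / t%:R) ^+ 2)%:E <=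
     (C / (t%:R * (level t)%:R ^+ 8))%:E)%E &
   forall n, (\sum_(i < n) \int[P]_w (Num.min (tail eps i.+1 w) 1)%:E <= M%:E)%E].

Lemma tail_ge0 eps t w : 0 <= tail eps t w.
Proof. by rewrite divr_ge0// normc_ge0. Qed.

Lemma tailE eps t w : tail eps t w =
  (if normc (eps t w) <= cutoff R t then 0 else normc (eps t w)) / t%:R.
Proof.
by rewrite /tail /body /truncate; case: ifP => _; rewrite ?subrr ?subr0 ?normc0.
Qed.

Lemma measurable_normc_RV eps t : measurable_fun setT (fun w => normc (eps t w)).
Proof.
apply: (@measurableT_comp _ _ _ _ _ _ (fun x : R[i] => normc x)).
  exact: measurable_normc.
exact: measurable_funPT.
Qed.

Lemma measurable_tail eps t : measurable_fun setT (tail eps t).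
Proof.
rewrite (_ : tail eps t = fun w =>
  (if normc (eps t w) <= cutoff R t then 0 else normc (eps t w)) / t%:R).
  apply: measurable_funM => //; apply: measurable_fun_ifT => //.
    by apply: measurable_fun_ler => //; exact: measurable_normc_RV.
  exact: measurable_normc_RV.
by apply/funext => w; exact: tailE.
Qed.

(** Below the cutoff, [ae_truncated_bounded]; above it, the tails sum absolutely
    almost surely. *)
Lemma ae_noise_bounded eps : mutually_independent eps -> tame eps ->
  {ae P, forall w, exists B, forall z m, normc z <= 1 ->
    normc (\sum_(1 <= t < m.+1) eps t w / t%:R * z ^+ t) <= B}.
Proof.
move=> indep [C [e [M [C0 [e0 e_sum] mean mom tl]]]].
have tail_sum : {ae P, forall w, bounded_sums (fun i => Num.min (tail eps i.+1 w) 1)}.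
  apply: (ae_bounded_sums (M := M)) => //.
  - by move=> i; apply: measurable_minr => //; exact: measurable_tail.
  - by move=> i w; rewrite le_min tail_ge0 ler01.
have := ae_truncated_bounded indep C0 e0 e_sum mean mom.
move: tail_sum; apply: filterS2 => w ts [B hB].
have [M' hM'] := bounded_sums_min1 (fun i => tail_ge0 eps i.+1 w) ts.
exists (B + M') => z m z1.
have -> : \sum_(1 <= t < m.+1) eps t w / t%:R * z ^+ t =
    \sum_(1 <= t < m.+1) body eps t w / t%:R * z ^+ t +
    \sum_(1 <= t < m.+1) (eps t w - body eps t w) / t%:R * z ^+ t.
  by rewrite -big_split; apply: eq_bigr => t _; rewrite /= -!mulrDl addrC subrK.
apply: (le_trans (le_normcD _ _)); apply: lerD; first exact: hB.
apply: le_trans (hM' m); rewrite -(big_mkord xpredT (fun i => tail eps i.+1 w)).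
rewrite -[leRHS](@big_add1 _ _ _ 0 m.+1 xpredT (fun i => tail eps i w)).
apply: (le_trans (normc_sum _ _ _)); apply: ler_sum => t _.
rewrite !normcM normcV normc_nat normcX /tail ler_piMr// ?exprn_ile1 ?normc_ge0//.
by rewrite divr_ge0 ?normc_ge0.
Qed.

End tame.

Section laws.
Context (R : realType) (d : measure_display) (T : measurableType d).
Context (P : probability T R).

Lemma integral_same_law d' (T' : measurableType d') (X Y : T -> T') (g : T' -> R) :
  measurable_fun setT X -> measurable_fun setT Y ->
  (forall B, measurable B -> P (X @^-1` B) = P (Y @^-1` B)) ->
  measurable_fun setT g -> (forall x, 0 <= g x) ->
  (\int[P]_w (g (X w))%:E = \int[P]_w (g (Y w))%:E)%E.
Proof.
move=> mX mY XY mg g0.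
have mEg : measurable_fun setT (EFin \o g) by exact/measurable_EFinP.
have := ge0_integral_pushforward mX P measurableT mEg (fun y _ => g0 y).
have := ge0_integral_pushforward mY P measurableT mEg (fun y _ => g0 y).
rewrite !preimage_setT => <- <-.
apply: eq_measure_integral => /= A mA _; exact: XY.
Qed.

Lemma measurable_oppC : measurable_fun [set: R[i]] (fun x : R[i] => - x).
Proof.
move=> _ B mB; rewrite setTI.
have : measurable_fun [set: R * R] (fun p : R * R => (- p.1, - p.2)).
  by apply: measurable_fun_pair; apply: measurableT_comp.
move=> /(_ measurableT _ mB); rewrite setTI; exact.
Qed.

(** Positive and negative part of an odd function of X have the same law. *)
Lemma integral_symmetric_odd (X : {RV P >-> R[i]}) (g : R[i] -> R) (b : R) :
  symmetric_RV X -> measurable_fun setT g -> (forall x, g (- x) = - g x) ->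
  (forall x, `|g x| <= b) -> (\int[P]_w (g (X w))%:E = 0)%E.
Proof.
move=> symX mg godd gb.
have mX : measurable_fun setT X by exact: measurable_funPT.
have mNX : measurable_fun setT (fun w => - X w).
  exact: (measurableT_comp measurable_oppC mX).
have ig : P.-integrable setT (EFin \o (fun w => g (X w))).
  by apply: (@bounded_integrable _ _ _ _ _ b) => //; exact: measurableT_comp.
have mg' : measurable_fun setT (fun x => Num.max (g x) 0) by exact: measurable_maxr.
have := integral_same_law mX mNX symX mg' (fun x => _).
move=> /(_ (fun x => _)) h.
rewrite integralE.
have e1 : (\int[P]_w (fun w => (g (X w))%:E)^\+ w = \int[P]_w (Num.max (g (X w)) 0)%:E)%E.
  by apply: eq_integral => w _; rewrite funeposE -EFin_max.
have e2 : (\int[P]_w (fun w => (g (X w))%:E)^\- w = \int[P]_w (Num.max (g (- X w)) 0)%:E)%E.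
  by apply: eq_integral => w _; rewrite funenegE -EFin_max godd.
rewrite e1 e2 h ?subee//; last first.
  by move=> x; rewrite le_max lexx orbT.
rewrite -e2; exact: integrable_neg_fin_num.
Qed.

End laws.

(** * Counting the times at which a value exceeds the cutoff *)

Section counting.
Context (R : realType).
Implicit Types (x p q : R) (b : nat -> bool).

(** Induction on n, remembering the last index l at which b holds: up to it,
    the count is at most l - p + 1. *)
Lemma count_between b p q n : (forall j, b j -> p < j%:R < q) -> p <= q ->
  \sum_(j < n) (b j)%:R <= q - p + 1.
Proof.
move=> bpq pq.
suff [->|[l [ln bl h]]] : \sum_(j < n) (b j)%:R = 0 :> R \/
    exists l, [/\ (l < n)%N, b l & \sum_(j < n) (b j)%:R <= l%:R - p + 1].
- by rewrite addr_ge0// subr_ge0.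
- by apply: (le_trans h); have /andP[_] := bpq _ bl; lra.
elim: n => [|n ih]; first by left; rewrite big_ord0.
rewrite big_ord_recr/=; case: (boolP (b n)) => bn; last first.
  rewrite addr0; case: ih => [->|[l [ln bl h]]]; [by left|right].
  by exists l; rewrite ltnW.
right; exists n; split => //; have /andP[pn _] := bpq _ bn.
rewrite -[true%:R]/(1 : R); case: ih => [->|[l [ln bl h]]]; first by lra.
have : l%:R + 1 <= n%:R :> R by rewrite natr1 ler_nat.
by move: h; lra.
Qed.

(** The reciprocals over a dyadic block sum to at most 1, so a block in which
    the condition c ever holds costs at most x. *)
Lemma block_sum_le x (c : nat -> bool) (b : bool) j : 0 <= x ->
  (forall t, (2 ^ j <= t < 2 ^ j.+1)%N -> c t -> b) ->
  \sum_(2 ^ j <= t < 2 ^ j.+1) (if c t then x / t%:R else 0) <= x * b%:R.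
Proof.
move=> x0; case: b => cb.
  apply: (@le_trans _ _ (\sum_(2 ^ j <= t < 2 ^ j.+1) x / t%:R)).
    by apply: ler_sum => t _; case: ifP => // _; rewrite divr_ge0.
  by rewrite -mulr_sumr ler_wpM2l// sum_inv_block.
rewrite mulr0 big_nat_cond big1// => t /andP[h _].
by case: ifPn => // /(cb _ h).
Qed.

Lemma ln2_ge : 2^-1 <= ln 2 :> R.
Proof.
rewrite -ler_expR lnK ?posrE//.
by apply: (le_trans (expR_le_quadratic (lexx _))); lra.
Qed.

(** Collects the constants in 8 ln (j + 1) <= (j + 1) / 4 + 8 ln 32, where the
    slope 1/4 leaves half of the lower bound 1/2 for ln 2. *)
Definition log_cst : R := 1 + 32 * ln 32.

Lemma log_cst_ge1 : 1 <= log_cst.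
Proof. by rewrite /log_cst lerDl mulr_ge0// ln_ge0// ler1n. Qed.

Lemma level_lt x j : 0 < x -> 2 ^+ j < x * j.+1%:R ^+ 8 ->
  j%:R * ln 2 < ln x + 8 * ln j.+1%:R.
Proof.
move=> x0; have j0 : 0 < j.+1%:R :> R by rewrite ltr0n.
move=> h; have : ln (2 ^+ j) < ln (x * j.+1%:R ^+ 8) :> R.
  by rewrite ltr_ln ?posrE ?mulr_gt0 ?exprn_gt0.
by rewrite lnM ?posrE ?exprn_gt0// !lnXn// -[_ *+ j]mulr_natl -[_ *+ 8]mulr_natl.
Qed.

Lemma level_lt_log x j : 0 < x -> 2 ^+ j < x * j.+1%:R ^+ 8 ->
  j%:R < 4 * ln x + log_cst.
Proof.
move=> x0 /(level_lt x0) h; have j0 : 0 < j.+1%:R :> R by rewrite ltr0n.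
have l2 : j%:R * 2^-1 <= j%:R * ln 2 :> R by rewrite ler_wpM2l// ln2_ge.
have : ln (j.+1%:R / 32) < j.+1%:R / 32 :> R.
  by apply: ln_sublinear; rewrite divr_gt0.
rewrite lnM ?posrE// lnV ?posrE// /log_cst -[j.+1%:R in X in _ < X]natr1 => h'.
by move: h; lra.
Qed.

Lemma cutoff_block x j t : (2 ^ j <= t < 2 ^ j.+1)%N -> cutoff R t < x ->
  2 ^+ j < x * j.+1%:R ^+ 8.
Proof.
move=> h; rewrite /cutoff (level_block h) ltr_pdivrMr ?exprn_gt0 ?ltr0n//.
by apply: le_lt_trans; rewrite -natrX ler_nat; case/andP: h.
Qed.

(** If x exceeds the cutoff on block j, then j <= 4 ln x + O(1). *)
Lemma sum_large_log x n : 0 <= x ->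
  \sum_(1 <= t < n) (if cutoff R t < x then x / t%:R else 0) <=
  x * (4 * Num.max (ln x) 0 + log_cst + 2).
Proof.
rewrite le_eqVlt => /predU1P[<-|x0].
  by rewrite mul0r big1// => t _; rewrite mul0r if_same.
set L := Num.max _ _; have L0 : 0 <= L by rewrite le_max lexx orbT.
have xL : ln x <= L by rewrite le_max lexx.
pose b j := 2 ^+ j < x * j.+1%:R ^+ 8.
apply: (@le_trans _ _ (\sum_(j < n) x * (b j)%:R)).
  apply: (@sum_le_dyadic _ _ (fun j => x * (b j)%:R)).
  - by move=> t; case: ifP => // _; rewrite divr_ge0// ltW.
  - by move=> j; apply: block_sum_le; [exact: ltW|move=> t; exact: cutoff_block].
rewrite -mulr_sumr ler_wpM2l ?(ltW x0)//.
apply: (le_trans (@count_between b (-1) (4 * L + log_cst) n _ _)).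
- move=> j /(level_lt_log x0) h; rewrite (lt_le_trans (ltrN10 _))//=.
  by apply: (lt_le_trans h); lra.
- by have := log_cst_ge1; lra.
- lra.
Qed.

(** Times t <= x are counted with weight 1 and number at most x.  On the later
    blocks 2^(j+1) > x and 2^j < x (j + 1)^8, which confines j to an interval of
    length 8 ln (j + 1) / ln 2 + 1, and ln (j + 1) = O(1) + ln ln (x + e) because
    j = O(1 + ln x). *)
Lemma sum_large_loglog x n : 0 <= x ->
  \sum_(1 <= t < n) (if cutoff R t < x then Num.min (x / t%:R) 1 else 0) <=
  x + 3 + x * (16 * (ln (log_cst + 5) + ln (ln (x + expR 1))) + 2).
Proof.
move=> x0; have := log_cst_ge1; set A := log_cst => A1.
have e2 : 2 <= expR 1 :> R by rewrite (le_trans _ (expR_ge1Dx 1)).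
have lx1 : 1 <= ln (x + expR 1).
  by rewrite -[X in X <= _]expRK ler_ln ?posrE ?expR_gt0 ?lerDr// ltr_wpDl// expR_gt0.
have llx0 : 0 <= ln (ln (x + expR 1)) by rewrite ln_ge0.
have lA0 : 0 <= ln (A + 5) by rewrite ln_ge0//; lra.
pose c (t : nat) := (x < t%:R) && (cutoff R t < x).
pose small (t : nat) := (t%:R <= x).
apply: (@le_trans _ _ (\sum_(1 <= t < n) (small t)%:R +
   \sum_(1 <= t < n) (if c t then x / t%:R else 0))).
  rewrite -big_split; apply: ler_sum => t _ /=.
  rewrite /small /c.
  case: (leP t%:R x) => tx /=; last first.
    by rewrite add0r; case: ifP => // _; rewrite ge_min lexx.
  by rewrite addr0; case: ifP => // _; rewrite ge_min lexx orbT.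
apply: lerD.
  rewrite big_add1 big_mkord.
  apply: (le_trans (@count_between (fun t => small t.+1) (-1) (x + 1) _ _ _));
    last 2 first.
  - by lra.
  - by lra.
  by move=> j; rewrite /small -natr1 => h; have := ler0n R j; lra.
have [->|xn0] := eqVneq x 0.
  rewrite mul0r big1// => t _; rewrite mul0r if_same//.
have xp : 0 < x by rewrite lt_neqAle eq_sym xn0.
set L := Num.max (ln x) 0; have L0 : 0 <= L by rewrite le_max lexx orbT.
have xL : ln x <= L by rewrite le_max lexx.
pose b j := (x < 2 ^+ j.+1) && (2 ^+ j < x * j.+1%:R ^+ 8).
apply: (@le_trans _ _ (\sum_(j < n) x * (b j)%:R)).
  apply: (@sum_le_dyadic _ _ (fun j => x * (b j)%:R)).
  - by move=> t; case: ifP => // _; rewrite divr_ge0.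
  - move=> j; apply: block_sum_le => // t tj /andP[xt ct].
    rewrite /b (cutoff_block tj ct) andbT (lt_trans xt)// -natrX ltr_nat.
    by case/andP: tj.
rewrite -mulr_sumr ler_wpM2l//.
have l20 : 0 < ln 2 :> R by rewrite (lt_le_trans _ ln2_ge).
set B := 8 * ln (4 * L + A + 1).
have B0 : 0 <= B by rewrite /B mulr_ge0// ln_ge0//; lra.
apply: (le_trans (@count_between b (ln x / ln 2 - 1) ((ln x + B) / ln 2) n _ _)).
- move=> j /andP[xj jx]; apply/andP; split.
    rewrite ltrBlDr natr1 ltr_pdivrMr// mulr_natl -lnXn// ltr_ln ?posrE ?exprn_gt0//.
  rewrite ltr_pdivlMr//; apply: (lt_le_trans (level_lt xp jx)).
  rewrite lerD2l /B ler_wpM2l// ler_ln ?posrE ?ltr0n//; last by lra.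
  by have := level_lt_log xp jx; rewrite -/A -natr1; lra.
- have : 0 <= B / ln 2 by rewrite divr_ge0// ltW.
  by rewrite mulrDl; lra.
have -> : (ln x + B) / ln 2 - (ln x / ln 2 - 1) + 1 = B / ln 2 + 2.
  by rewrite mulrDl; lra.
rewrite lerD2r ler_pdivrMr//.
apply: (@le_trans _ _ (16 * (ln (A + 5) + ln (ln (x + expR 1))) * 2^-1)); last first.
  by rewrite ler_wpM2l ?ln2_ge// mulr_ge0// addr_ge0.
rewrite /B (_ : 16 * _ * 2^-1 = 8 * (ln (A + 5) + ln (ln (x + expR 1)))); last by lra.
rewrite ler_wpM2l// -lnM ?posrE; [|lra|lra].
have Lx : L <= ln (x + expR 1).
  rewrite ge_max (le_trans ler01)// andbT ler_ln ?posrE//; last by lra.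
  by rewrite lerDl expR_ge0.
rewrite ler_ln ?posrE; [nra|lra|nra].
Qed.

End counting.

(** * The three noise conditions *)

Section moments.
Context (R : realType) (d : measure_display) (T : measurableType d).
Context (P : probability T R).

Lemma integrable_bounded_below (Y : T -> R) : measurable_fun setT Y ->
  (forall w, -1 <= Y w) -> (\int[P]_w (Y w)%:E < +oo)%E ->
  P.-integrable setT (EFin \o Y).
Proof.
move=> mY Y1 Yoo; have mEY : measurable_fun setT (EFin \o Y) by exact/measurable_EFinP.
have mp : measurable_fun setT ((EFin \o Y)^\+)%E by exact: measurable_funepos.
have mn : measurable_fun setT ((EFin \o Y)^\-)%E by exact: measurable_funeneg.
have n1 : (\int[P]_w ((EFin \o Y)^\- w) <= 1)%E.
  apply: (@le_trans _ _ (\int[P]_w (cst 1%:E) w)%E).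
    apply: ge0_le_integral => // w _.
    by rewrite funenegE ge_max -EFinN !lee_fin ler01 andbT; have := Y1 w; lra.
  by rewrite integral_cst// [X in (_ * X)%E]probability_setT mule1.
have nfin : (\int[P]_w ((EFin \o Y)^\- w))%E \is a fin_num.
  rewrite ge0_fin_numE; first exact: (le_lt_trans n1 (ltry _)).
  by apply: integral_ge0.
have pfin : (\int[P]_w ((EFin \o Y)^\+ w) < +oo)%E.
  rewrite ltNge leye_eq; apply/negP => /eqP poo.
  move: Yoo; rewrite integralE poo.
  by case: (\int[P]_w _)%E nfin.
apply/integrableP; split => //.
rewrite -[fun x => _]/(abse \o (EFin \o Y)) fune_abse ge0_integralD//.
by rewrite lte_add_pinfty// (le_lt_trans n1)// ltry.
Qed.

(** The hypotheses on the noise bound an integral that may have a negative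
    part; as long as the integrand is bounded below, it dominates. *)
Lemma domination (X : {RV P >-> R[i]}) (F : R -> R) (a b : R) :
  measurable_fun setT F -> (forall x, 0 <= x -> -1 <= F x) ->
  (\int[P]_w (F (normc (X w)))%:E < +oo)%E ->
  exists2 M : R, 0 <= M & forall phi : R -> R, measurable_fun setT phi ->
    (forall x, 0 <= phi x) -> (forall x, 0 <= x -> phi x <= a + b * F x) ->
    (\int[P]_w (phi (normc (X w)))%:E <= M%:E)%E.
Proof.
move=> mF F1 Foo.
have mX : measurable_fun setT (fun w => normc (X w)).
  exact: (measurable_normc_RV (fun=> X) 0).
have iF : P.-integrable setT (EFin \o (fun w => F (normc (X w)))).
  apply: integrable_bounded_below => // [|w]; first exact: measurableT_comp.
  by apply: F1; exact: normc_ge0.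
have iaF : P.-integrable setT (fun w => (a + b * F (normc (X w)))%:E).
  under eq_fun do rewrite EFinD EFinM.
  apply: integrableD => //; first exact: finite_measure_integrable_cst.
  exact: (integrableZl _ _ iF).
exists (Num.max (fine (\int[P]_w (a + b * F (normc (X w)))%:E)) 0).
  by rewrite le_max lexx orbT.
move=> phi mphi phi0 phiF.
apply: (@le_trans _ _ (\int[P]_w (a + b * F (normc (X w)))%:E)%E).
  apply: ge0_le_integral => //.
  - by move=> w _; rewrite lee_fin.
  - by apply/measurable_EFinP; exact: measurableT_comp.
  - exact: measurable_int iaF.
  - by move=> w _; rewrite lee_fin phiF// normc_ge0.
rewrite -[X in (X <= _)%E]fineK; last exact: integrable_fin_num.
by rewrite lee_fin le_max lexx.
Qed.

Lemma first_moment_le (X : {RV P >-> R[i]}) (F : R -> R) (a b : R) :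
  measurable_fun setT F -> (forall x, 0 <= x -> -1 <= F x) ->
  (\int[P]_w (F (normc (X w)))%:E < +oo)%E ->
  (forall x, 0 <= x -> x <= a + b * F x) ->
  exists2 C : R, 0 <= C & (\int[P]_w (normc (X w))%:E <= C%:E)%E.
Proof.
move=> mF F1 Foo xF; have [C C0 hC] := domination a b mF F1 Foo.
exists C => //; apply: le_trans (hC (fun x => Num.max x 0) _ _ _).
- by apply/eqW/eq_integral => w _; congr EFin; apply/esym/max_idPl; exact: normc_ge0.
- exact: measurable_maxr.
- by move=> x; rewrite le_max lexx orbT.
- by move=> x x0; rewrite (max_idPl _)// xF.
Qed.

(** For identically distributed variables the sum over t can be taken inside a
    single expectation, where it is estimated for each value of the variable. *)
Lemma iid_sum_le (eps : nat -> {RV P >-> R[i]}) (F : R -> R) (a b : R)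
    (phi : nat -> R -> R) : identically_distributed eps ->
  measurable_fun setT F -> (forall x, 0 <= x -> -1 <= F x) ->
  (\int[P]_w (F (normc (eps 1%N w)))%:E < +oo)%E ->
  (forall t, measurable_fun setT (phi t)) -> (forall t x, 0 <= phi t x) ->
  (forall n x, 0 <= x -> \sum_(1 <= t < n) phi t x <= a + b * F x) ->
  exists M, forall n,
    (\sum_(i < n) \int[P]_w (phi i.+1 (normc (eps i.+1 w)))%:E <= M%:E)%E.
Proof.
move=> id mF F1 Foo mphi phi0 phiF.
have [M _ hM] := domination a b mF F1 Foo.
exists M => n.
have mX : measurable_fun setT (fun w => normc (eps 1%N w)).
  exact: measurable_normc_RV.
apply: (@le_trans _ _ (\sum_(i < n) \int[P]_w (phi i.+1 (normc (eps 1%N w)))%:E)%E).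
  apply: lee_sum => i _; rewrite le_eqVlt; apply/orP; left; apply/eqP.
  apply: (integral_same_law (X := eps i.+1) (Y := eps 1%N)
    (g := fun x => phi i.+1 (normc x))) => //.
  - by move=> B mB; exact: id.
  - by apply: measurableT_comp => //; exact: measurable_normc.
rewrite -ge0_integral_sum//; last 2 first.
- by move=> i; apply/measurable_EFinP; exact: measurableT_comp.
- by move=> i w _; rewrite lee_fin.
under eq_integral do rewrite sumEFin.
apply: (hM (fun x => \sum_(i < n) phi i.+1 x)).
- exact: measurable_sum.
- by move=> x; rewrite sumr_ge0.
move=> x x0; apply: le_trans (phiF n.+1 x x0).
by rewrite big_add1 big_mkord.
Qed.

(** Below the cutoff the square is at most cutoff * |eps_t|. *)
Lemma iid_body_moment (eps : nat -> {RV P >-> R[i]}) (C : R) :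
  identically_distributed eps ->
  (\int[P]_w (normc (eps 1%N w))%:E <= C%:E)%E ->
  forall t : nat, (1 <= t)%N ->
    (\int[P]_w ((normc (body eps t w) / t%:R) ^+ 2)%:E <=
     (C / (t%:R * (level t)%:R ^+ 8))%:E)%E.
Proof.
move=> id hC t t1.
have t0 : 0 < t%:R :> R by rewrite ltr0n.
have l0 : 0 < (level t)%:R ^+ 8 :> R by rewrite exprn_gt0// ltr0n.
have meps s : measurable_fun setT (eps s) by exact: measurable_funPT.
have mn : measurable_fun [set: R[i]] (fun x : R[i] => normc x) by exact: measurable_normc.
have mnx : measurable_fun setT (fun w => normc (eps t w)) by exact: measurable_normc_RV.
apply: (@le_trans _ _ (\int[P]_w ((t%:R * (level t)%:R ^+ 8)^-1%:E *
    (normc (eps t w))%:E))%E).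
  apply: ge0_le_integral => //.
  - by move=> w _; rewrite lee_fin sqr_ge0.
  - apply/measurable_EFinP/measurable_funX/measurable_funM => //.
    apply: (@measurableT_comp _ _ _ _ _ _ (fun x => normc (truncate (cutoff R t) x))) => //.
    exact: measurable_comp_truncate.
  - by apply: measurable_funeM; apply/measurable_EFinP.
  move=> w _; rewrite -EFinM lee_fin exprMn expr2.
  have b1 := normc_truncate (eps t w) (cutoff_ge0 R t).
  have b2 : normc (body eps t w) <= normc (eps t w).
    by rewrite /body /truncate; case: ifP => // _; rewrite normc0 normc_ge0.
  apply: (@le_trans _ _ (cutoff R t * normc (eps t w) * t%:R^-1 ^+ 2)).
    by rewrite ler_wpM2r ?sqr_ge0// ler_pM ?normc_ge0.
  rewrite /cutoff le_eqVlt; apply/orP; left; apply/eqP.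
  have ln0 : (level t)%:R != 0 :> R by rewrite pnatr_eq0.
  have tn0 : t%:R != 0 :> R by rewrite gt_eqF.
  by move: ((level t)%:R : R) (t%:R : R) ln0 tn0 => l s ln0 sn0; field; rewrite ln0.
rewrite ge0_integralZl//; last 2 first.
- exact/measurable_EFinP.
- by move=> w _; rewrite lee_fin normc_ge0.
have -> : (\int[P]_w (normc (eps t w))%:E = \int[P]_w (normc (eps 1%N w))%:E)%E.
  apply: (integral_same_law (g := fun x => normc x)) => //.
  - by move=> B mB; exact: id.
  - exact: normc_ge0.
by rewrite [(C / _)%R]mulrC EFinM lee_wpmul2l// lee_fin invr_ge0 mulr_ge0// ltW.
Qed.

Lemma body_mean_symmetric (eps : nat -> {RV P >-> R[i]}) t (a : R[i]) :
  (1 <= t)%N -> symmetric_RV (eps t) -> normc a <= 1 ->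
  (\int[P]_w (complex.Re (a * body eps t w) / t%:R)%:E = 0)%E.
Proof.
move=> t1 sym a1.
apply: (@integral_symmetric_odd _ _ _ _ (eps t)
  (fun x => complex.Re (a * truncate (cutoff R t) x) / t%:R) (cutoff R t / t%:R) sym).
- apply: measurable_funM => //.
  exact: measurable_Re_truncate.
- move=> x; rewrite /truncate normcN.
  case: ifP => _; rewrite ?mulrN ?mulr0/= ?mul0r ?oppr0//.
  by case: (a * x) => p q /=; rewrite mulNr.
- move=> x; rewrite normrM (ger0_norm (x := t%:R^-1)) ?invr_ge0// ler_wpM2r ?invr_ge0//.
  apply: (le_trans (normc_ge_Re _)); rewrite normcM.
  apply: (@le_trans _ _ (1 * cutoff R t)); last by rewrite mul1r.
  by rewrite ler_pM ?normc_ge0// normc_truncate// cutoff_ge0.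
Qed.

Lemma measurable_large t (f : R -> R) : measurable_fun setT f ->
  measurable_fun setT (fun x => if cutoff R t < x then f x else 0).
Proof.
by move=> mf; apply: measurable_fun_ifT => //; apply: measurable_fun_ltr.
Qed.

Lemma tail_large (eps : nat -> {RV P >-> R[i]}) t w : tail eps t w =
  if cutoff R t < normc (eps t w : R[i]) then normc (eps t w) / t%:R else 0 :> R.
Proof. by rewrite tailE; case: leP => //; rewrite mul0r. Qed.

(** As eps_t is centred, the mean of its truncation is minus the mean of the
    tail, so the summability of the tail expectations bounds both. *)
Lemma noise_N1_tame (eps : nat -> {RV P >-> R[i]}) : noise_N1 eps -> tame eps.
Proof.
move=> [_ [id N1]].
have [[iRe iIm ERe EIm] Foo] := N1 1%N isT.
pose F (x : R) := x * ln x.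
have mF : measurable_fun setT F by apply: measurable_funM => //; exact: measurable_ln.
have F1 x : 0 <= x -> -1 <= F x.
  rewrite le_eqVlt => /predU1P[<-|x0]; first by rewrite /F mul0r oppr_le0 ler01.
  have := ln_sublinear; move=> /(_ R x^-1); rewrite invr_gt0 => /(_ x0).
  rewrite lnV ?posrE// => h; rewrite lerNl -mulrN -ler_pdivlMl// mulr1.
  exact: ltW.
rewrite unlock in Foo.
have e2 : 2 <= expR 1 :> R by rewrite (le_trans _ (expR_ge1Dx 1)).
have xF x : 0 <= x -> x <= expR 1 + 1 + F x.
  move=> x0; have [xe|xe] := leP x (expR 1); first by have := F1 x x0; lra.
  have x1 : 0 < x by rewrite (lt_trans _ xe)// expR_gt0.
  have : 1 <= ln x.
    by rewrite -[X in X <= _](@expRK R) ler_ln ?posrE ?expR_gt0//; exact: ltW.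
  by rewrite /F => lx; have : x * 1 <= x * ln x by [rewrite ler_wpM2l]; lra.
have LF x : 0 <= x -> x * Num.max (ln x) 0 <= 1 + F x.
  move=> x0; rewrite maxr_pMr// ge_max -/(F x) mulr0.
  by have := F1 x x0; lra.
have A1 := log_cst_ge1 R; set A := log_cst R in A1.
pose phi t (x : R) := if cutoff R t < x then x / t%:R else 0.
have mphi t : measurable_fun setT (phi t).
  by apply: measurable_large; exact: measurable_funM.
have phi0 t x : 0 <= phi t x.
  rewrite /phi; case: ifP => // cx; rewrite divr_ge0// ltW// (le_lt_trans _ cx)//.
  exact: cutoff_ge0.
have [C C0 C1] : exists2 C : R, 0 <= C & (\int[P]_w (normc (eps 1%N w))%:E <= C%:E)%E.
  apply: (first_moment_le (a := expR 1 + 1) (b := 1) mF F1 Foo) => x x0.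
  by rewrite mul1r xF.
have [M hM] : exists M, forall n,
    (\sum_(i < n) \int[P]_w (phi i.+1 (normc (eps i.+1 w)))%:E <= M%:E)%E.
  apply: (iid_sum_le (F := F) (a := (A + 2) * (expR 1 + 1) + 4) (b := A + 6)) => //.
  move=> n x x0; apply: (le_trans (sum_large_log n x0)); rewrite -/A.
  have : x * (A + 2) <= (expR 1 + 1 + F x) * (A + 2).
    by rewrite ler_wpM2r ?xF//; lra.
  by have := LF x x0; lra.
have tail_phi t w : tail eps t w = phi t (normc (eps t w)) by exact: tail_large.
have intX t w : (1 <= t)%N -> tail eps t w <= normc (eps t w).
  move=> t1; rewrite tail_large; case: ifP => _; last exact: normc_ge0.
  by rewrite ler_pdivrMr ?ltr0n// ler_peMr ?normc_ge0// ler1n.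
have mtail t : measurable_fun setT (fun w => (tail eps t w)%:E).
  by apply/measurable_EFinP; exact: measurable_tail.
have mnorm t : measurable_fun setT (fun w => (normc (eps t w))%:E).
  by apply/measurable_EFinP; exact: measurable_normc_RV.
have tailC t : (1 <= t)%N -> (\int[P]_w (tail eps t w)%:E <= C%:E)%E.
  move=> t1; apply: le_trans C1.
  apply: (@le_trans _ _ (\int[P]_w (normc (eps t w))%:E)%E).
    by apply: ge0_le_integral => // w _; rewrite lee_fin ?tail_ge0 ?intX.
  apply/eqW/(integral_same_law (g := fun x => normc x)) => //.
  - by move=> B mB; exact: id.
  - exact: measurable_normc.
  - exact: normc_ge0.
pose e t := fine (\int[P]_w (tail eps t w)%:E)%E.
have tail0 t : (0 <= \int[P]_w (tail eps t w)%:E)%E.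
  by apply: integral_ge0 => w _; rewrite lee_fin tail_ge0.
have tail_fin t : (1 <= t)%N -> (\int[P]_w (tail eps t w)%:E)%E \is a fin_num.
  by move=> t1; rewrite ge0_fin_numE// (le_lt_trans (tailC t t1)) ?ltry.
have tailM n : (\sum_(i < n) \int[P]_w (tail eps i.+1 w)%:E <= M%:E)%E.
  apply: le_trans (hM n); apply/eqW/eq_bigr => i _.
  by apply: eq_integral => w _; rewrite tail_phi.
exists C, e, M; split => //.
- split=> [t|]; first exact: fine_ge0.
  exists M => n; rewrite -lee_fin; apply: le_trans (tailM n).
  by rewrite -sumEFin; apply/eqW/eq_bigr => i _; rewrite /e fineK// tail_fin.
- move=> t a t1 a1; rewrite /e fineK ?tail_fin//.
  have itail : P.-integrable setT (fun w => (tail eps t w)%:E).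
    apply/integrableP; split => //.
    under eq_integral do rewrite gee0_abs ?lee_fin ?tail_ge0//.
    by rewrite (le_lt_trans (tailC t t1)) ?ltry.
  have [[iRet iImt ERet EImt] _] := N1 t t1.
  rewrite unlock in ERet; rewrite unlock in EImt.
  pose p := complex.Re a / t%:R; pose q := - (complex.Im a / t%:R).
  have ip : P.-integrable setT (fun w => p%:E * (complex.Re (eps t w))%:E)%E.
    exact: integrableZl.
  have iq : P.-integrable setT (fun w => q%:E * (complex.Im (eps t w))%:E)%E.
    exact: integrableZl.
  apply: (@le_trans _ _ (\int[P]_w ((p%:E * (complex.Re (eps t w))%:E +
      q%:E * (complex.Im (eps t w))%:E) + (tail eps t w)%:E))%E).
    apply: le_integral => //.
    + apply: (@bounded_integrable _ _ _ _ _ (cutoff R t / t%:R)).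
        apply: measurable_funM => //.
        apply: (@measurableT_comp _ _ _ _ _ _
            (fun x => complex.Re (a * truncate (cutoff R t) x))).
          exact: measurable_Re_truncate.
        exact: measurable_funPT.
      move=> w; rewrite normrM (ger0_norm (x := t%:R^-1)) ?invr_ge0// ler_wpM2r ?invr_ge0//.
      apply: (le_trans (normc_ge_Re _)); rewrite normcM -[leRHS]mul1r.
      by rewrite ler_pM ?normc_ge0// normc_truncate// cutoff_ge0.
    + by apply: integrableD => //; apply: integrableD.
    move=> w _; rewrite -!EFinM -!EFinD lee_fin.
    have -> : p * complex.Re (eps t w) + q * complex.Im (eps t w) =
        complex.Re (a * eps t w) / t%:R.
      by rewrite ReM /p /q; lra.
    rewrite -lerBlDl -mulrBl /tail ler_wpM2r ?invr_ge0//.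
    have -> : complex.Re (a * body eps t w) - complex.Re (a * eps t w) =
        complex.Re (a * (body eps t w - eps t w)).
      by rewrite !ReM; case: (body _ _ _) (eps t w) => ? ? [? ?] /=; ring.
    rewrite (le_trans (ler_norm _))// (le_trans (normc_ge_Re _))// normcM normcB.
    by rewrite ler_piMl ?normc_ge0.
  rewrite integralD//; last by apply: integrableD.
  by rewrite integralD// !integralZl// ERet EImt !mule0 !add0e.
- exact: iid_body_moment.
- move=> n; apply: le_trans (tailM n); apply: lee_sum => i _.
  apply: ge0_le_integral => //.
  + by move=> w _; rewrite lee_fin le_min tail_ge0 ler01.
  + by apply/measurable_EFinP/measurable_minr => //; exact: measurable_tail.
  + by move=> w _; rewrite lee_fin ge_min lexx.
Qed.

(** Symmetry makes the truncated means vanish, so that only the capped tail has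
    to be summable. *)
Lemma noise_N2_tame (eps : nat -> {RV P >-> R[i]}) : noise_N2 eps -> tame eps.
Proof.
move=> [_ [id N2]].
have [_ Foo] := N2 1%N isT.
rewrite unlock in Foo.
pose F (x : R) := x * ln (ln (x + expR 1)).
have mF : measurable_fun setT F.
  apply: measurable_funM => //; apply: (@measurableT_comp _ _ _ _ _ _ (@ln R)).
    exact: measurable_ln.
  apply: (@measurableT_comp _ _ _ _ _ _ (@ln R)); first exact: measurable_ln.
  exact: measurable_funD.
have e2 : 2 <= expR 1 :> R by rewrite (le_trans _ (expR_ge1Dx 1)).
have lx1 (x : R) : 0 <= x -> 1 <= ln (x + expR 1).
  move=> x0; rewrite -[X in X <= _](@expRK R) ler_ln ?posrE ?expR_gt0//; last by lra.
  by rewrite lerDr.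
have F0 x : 0 <= x -> 0 <= F x by move=> x0; rewrite mulr_ge0// ln_ge0// lx1.
have F1 x : 0 <= x -> -1 <= F x by move=> /F0; lra.
set K := expR (expR 1) : R.
have K0 : 0 < K by exact: expR_gt0.
have xF x : 0 <= x -> x <= K + F x.
  move=> x0; have := F0 _ x0; have [xe|xe] := leP x K; first by lra.
  have h : expR 1 <= ln (x + expR 1).
    rewrite -[X in X <= _](@expRK R) ler_ln ?posrE//; last by lra.
    by rewrite -/K; lra.
  have : 1 <= ln (ln (x + expR 1)).
    rewrite -[X in X <= _](@expRK R) ler_ln ?posrE ?expR_gt0//.
    by rewrite (lt_le_trans (expR_gt0 1)).
  by rewrite /F => lx; have : x * 1 <= x * ln (ln (x + expR 1)) by [rewrite ler_wpM2l]; lra.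
have A1 := log_cst_ge1 R; set A := log_cst R in A1.
have c0 : 0 <= ln (A + 5) by rewrite ln_ge0//; lra.
set c := ln (A + 5) in c0.
pose phi t (x : R) := if cutoff R t < x then Num.min (x / t%:R) 1 else 0.
have mphi t : measurable_fun setT (phi t).
  by apply: measurable_large; apply: measurable_minr => //; exact: measurable_funM.
have phi0 t x : 0 <= phi t x.
  rewrite /phi; case: ifP => // cx; rewrite le_min ler01 andbT.
  by rewrite divr_ge0// ltW// (le_lt_trans _ cx)// cutoff_ge0.
have [C C0 C1] : exists2 C : R, 0 <= C & (\int[P]_w (normc (eps 1%N w))%:E <= C%:E)%E.
  by apply: (first_moment_le (a := K) (b := 1) mF F1 Foo) => x x0; rewrite mul1r xF.
have [M hM] : exists M, forall n,
    (\sum_(i < n) \int[P]_w (phi i.+1 (normc (eps i.+1 w)))%:E <= M%:E)%E.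
  apply: (iid_sum_le (F := F) (a := 3 + (3 + 16 * c) * K) (b := 3 + 16 * c + 16)) => //.
  move=> n x x0; apply: (le_trans (sum_large_loglog n x0)); rewrite -/A -/c.
  have : x * (3 + 16 * c) <= (K + F x) * (3 + 16 * c).
    by rewrite ler_wpM2r ?xF//; lra.
  by rewrite /F; lra.
exists C, (fun=> 0), M; split => //.
- by split => //; exists 0 => n; rewrite big1.
- move=> t a t1 a1; have [sym _] := N2 t t1.
  by rewrite body_mean_symmetric.
- exact: iid_body_moment.
- move=> n; apply: le_trans (hM n); apply/eqW/eq_bigr => i _.
  apply: eq_integral => w _; rewrite tail_large /phi; case: ifP => // _.
  by rewrite (min_idPl _)// ler01.
Qed.

(** With dl = (1 - nu) ln 2, on block j one has t^(nu - 1) <= exp (- j dl), and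
    exp y >= y^10 / 10! turns this into a power of the level. *)
Lemma powR_le_level (nu : R) : nu < 1 -> exists2 K, 0 <= K &
  forall t, (1 <= t)%N -> t%:R `^ nu <= K * (t%:R / (level t)%:R ^+ 10).
Proof.
move=> nu1; have l2 : 0 < ln 2 :> R by rewrite (lt_le_trans _ (ln2_ge R)).
set dl := (1 - nu) * ln 2; have dl0 : 0 < dl by rewrite mulr_gt0// subr_gt0.
have [c c0 hc] : exists2 c : R, 0 < c & forall y, 0 <= y -> y ^+ 10 / c <= expR y.
  exists 10`!%:R; first by rewrite ltr0n fact_gt0.
  by move=> y y0; apply: le_trans (expR_ge1Dxn 9 y0); rewrite lerDr ler01.
exists (expR dl * c / dl ^+ 10).
  by rewrite divr_ge0 ?exprn_ge0 ?(ltW dl0)// mulr_ge0 ?expR_ge0// ltW.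
move=> t t1; have t0 : 0 < t%:R :> R by rewrite ltr0n.
have /andP[jt _] := trunc_log_bounds (isT : (1 < 2)%N) t1.
rewrite /level; set j := trunc_log 2 t in jt *.
have jt' : j%:R * ln 2 <= ln t%:R :> R.
  rewrite mulr_natl -lnXn// ler_ln ?posrE ?exprn_gt0//.
  by rewrite -natrX ler_nat.
rewrite /powR gt_eqF//.
have -> : nu * ln t%:R = ln t%:R + - ((1 - nu) * ln t%:R) by lra.
rewrite expRD lnK ?posrE// mulrCA ler_wpM2l ?(ltW t0)//.
apply: (@le_trans _ _ (expR (- (j%:R * dl)))).
  rewrite ler_expR lerN2 /dl mulrCA ler_wpM2l// subr_ge0; exact: ltW.
have -> : - (j%:R * dl) = dl - j.+1%:R * dl by rewrite -natr1; lra.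
rewrite expRD -!mulrA ler_wpM2l ?expR_ge0// expRN.
have j0 : 0 < j.+1%:R :> R by rewrite ltr0n.
have h := hc _ (mulr_ge0 (ltW j0) (ltW dl0)).
have p0 : 0 < (j.+1%:R * dl) ^+ 10 / c by rewrite divr_gt0// exprn_gt0// mulr_gt0.
apply: (@le_trans _ _ ((j.+1%:R * dl) ^+ 10 / c)^-1).
  by rewrite lef_pV2 ?posrE ?expR_gt0.
have jn0 : j.+1%:R ^+ 10 != 0 :> R by rewrite expf_neq0// gt_eqF.
have dn0 : dl ^+ 10 != 0 by rewrite expf_neq0// gt_eqF.
have cn0 : c != 0 by rewrite gt_eqF.
rewrite exprMn; clear -jn0 dn0 cn0; move: (j.+1%:R ^+ 10) (dl ^+ 10) jn0 dn0 => p q p0 q0.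
by rewrite le_eqVlt; apply/orP; left; apply/eqP; field; rewrite ?p0 ?q0 ?cn0.
Qed.

(** The second moment at t is O(t / level^10): two powers of the level more than
    needed below the cutoff, and these make the tail, which is at most
    |eps_t|^2 level^8 / t^2, summable over the blocks. *)
Lemma noise_N3_tame (eps : nat -> {RV P >-> R[i]}) : noise_N3 eps -> tame eps.
Proof.
move=> [_ [N3 [nu [nu1 hO]]]].
rewrite unlock in N3 hO.
pose second t := (\int[P]_w (normc (eps t w) ^+ 2)%:E)%E.
have second0 t : (0 <= second t)%E.
  by apply: integral_ge0 => w _; rewrite lee_fin sqr_ge0.
have second_fin t : (1 <= t)%N -> second t = (fine (second t))%:E.
  by move=> t1; rewrite fineK// ge0_fin_numE//; have [] := N3 t t1.
have [k k0 [n0 _ hk]] : exists2 k : R, 0 < k &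
    \forall t \near \oo, `|fine (second t)| <= k * `|t%:R `^ nu|.
  move/eqO_exP : hO => [k [k0 hk]].
  by exists k.
have [K0 K00 hK0] := powR_le_level nu1.
pose K1 := k + \sum_(i < n0) fine (second i) / i%:R `^ nu.
have term0 i : 0 <= fine (second i) / i%:R `^ nu.
  by rewrite divr_ge0 ?powR_ge0// fine_ge0.
have K10 : 0 <= K1 by rewrite addr_ge0 ?(ltW k0)// sumr_ge0.
have sec t : (1 <= t)%N ->
    (second t <= (K1 * K0 * (t%:R / (level t)%:R ^+ 10))%:E)%E.
  move=> t1; rewrite second_fin// lee_fin.
  apply: (@le_trans _ _ (K1 * t%:R `^ nu)); last first.
    by rewrite -mulrA ler_wpM2l// hK0.
  have tp : 0 < t%:R `^ nu :> R by rewrite powR_gt0// ltr0n.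
  have [tn0|tn0] := ltnP t n0.
    rewrite -ler_pdivrMr// /K1 (bigD1 (Ordinal tn0))//= addrCA lerDl.
    by rewrite addr_ge0 ?(ltW k0)// sumr_ge0.
  apply: (le_trans (ler_norm _)); apply: (le_trans (hk t tn0)).
  by rewrite ger0_norm ?powR_ge0// ler_wpM2r ?powR_ge0// /K1 lerDl sumr_ge0.
set K2 := K1 * K0 in sec.
have K20 : 0 <= K2 by rewrite mulr_ge0.
have msec t : measurable_fun setT (fun w => (normc (eps t w) ^+ 2)%:E).
  by apply/measurable_EFinP/measurable_funX; exact: measurable_normc_RV.
have scaled t (c : R) (Y : T -> R) : (1 <= t)%N -> 0 <= c -> measurable_fun setT Y ->
    (forall w, 0 <= Y w <= c * normc (eps t w) ^+ 2) ->
    (\int[P]_w (Y w)%:E <= (c * (K2 * (t%:R / (level t)%:R ^+ 10)))%:E)%E.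
  move=> t1 c0 mY Yc.
  apply: (@le_trans _ _ (\int[P]_w (c%:E * (normc (eps t w) ^+ 2)%:E))%E).
    apply: ge0_le_integral => //.
    - by move=> w _; rewrite lee_fin; have /andP[] := Yc w.
    - exact/measurable_EFinP.
    - exact: measurable_funeM.
    - by move=> w _; rewrite -EFinM lee_fin; have /andP[] := Yc w.
  rewrite ge0_integralZl//; last by move=> w _; rewrite lee_fin sqr_ge0.
  by rewrite EFinM lee_wpmul2l// sec.
have l0 t : (level t)%:R != 0 :> R by rewrite pnatr_eq0.
have tn0 t : (1 <= t)%N -> t%:R != 0 :> R by move=> t1; rewrite pnatr_eq0 -lt0n.
have [M hM] := bounded_sumsZ K20 (bounded_sums_inv_sqr R).
exists K2, (fun=> 0), M; split => //.
- by split => //; exists 0 => n; rewrite big1.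
- move=> t a t1 a1; have [sym _] := N3 t t1.
  by rewrite body_mean_symmetric.
- move=> t t1.
  have t0 : 0 < t%:R :> R by rewrite ltr0n.
  apply: (le_trans (scaled t (t%:R ^- 2) _ t1 _ _ _)).
  + by rewrite invr_ge0 sqr_ge0.
  + apply/measurable_funX/measurable_funM => //.
    apply: (@measurableT_comp _ _ _ _ _ _ (fun x => normc (truncate (cutoff R t) x))).
      by apply: measurable_comp_truncate; exact: measurable_normc.
    exact: measurable_funPT.
  + move=> w; rewrite sqr_ge0/= exprMn mulrC exprVn ler_wpM2l ?invr_ge0 ?sqr_ge0//.
    rewrite lerXn2r ?nnegrE ?normc_ge0// /body /truncate.
    by case: ifP => // _; rewrite normc0 normc_ge0.
  rewrite lee_fin.
  have -> : t%:R ^- 2 * (K2 * (t%:R / (level t)%:R ^+ 10)) =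
      K2 * (t%:R * (level t)%:R ^+ 10)^-1 :> R.
    move: (tn0 t t1) (l0 t) => h1 h2.
    move: (t%:R : R) ((level t)%:R : R) h1 h2 => p q p0 q0.
    by field; rewrite ?p0 ?q0.
  rewrite ler_wpM2l// lef_pV2 ?posrE ?mulr_gt0 ?exprn_gt0 ?ltr0n//.
  by rewrite ler_wpM2l ?(ltW t0)// ler_weXn2l// ler1n.
- move=> n; apply: le_trans
    (_ : (\sum_(i < n) K2 * (i.+1%:R * (level i.+1)%:R ^+ 2)^-1)%:E <= _)%E.
    rewrite -sumEFin; apply: lee_sum => i _.
    have i0 : 0 < i.+1%:R :> R by rewrite ltr0n.
    apply: (le_trans (scaled i.+1 ((level i.+1)%:R ^+ 8 / i.+1%:R ^+ 2) _ isT _ _ _)).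
    + by rewrite divr_ge0// exprn_ge0.
    + by apply: measurable_minr => //; exact: measurable_tail.
    + move=> w; rewrite le_min tail_ge0 ler01/= ge_min; apply/orP; left.
      rewrite tail_large; case: ifPn => cx; last first.
        by rewrite mulr_ge0 ?divr_ge0 ?exprn_ge0 ?normc_ge0.
      have x0 : 0 <= normc (eps i.+1 w) by exact: normc_ge0.
      move: cx; rewrite /cutoff ltr_pdivrMr ?exprn_gt0 ?ltr0n// => /ltW cx.
      move: cx; move: (normc _) x0 (tn0 i.+1 isT) i0 => x x0.
      move: (i.+1%:R : R) ((level i.+1)%:R ^+ 8 : R) => p q p0 pp cx.
      have -> : q / p ^+ 2 * x ^+ 2 = x / p * ((x * q) / p) by field.
      by rewrite ler_peMr ?divr_ge0 ?(ltW pp)// ler_pdivlMr// mul1r.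
    rewrite lee_fin le_eqVlt; apply/orP; left; apply/eqP.
    move: (tn0 i.+1 isT) (l0 i.+1) => h1 h2.
    move: (i.+1%:R : R) ((level i.+1)%:R : R) h1 h2 => p q p0 q0.
    by field; rewrite ?p0 ?q0.
  rewrite lee_fin.
  rewrite -(big_mkord xpredT (fun i => K2 * (i.+1%:R * (level i.+1)%:R ^+ 2)^-1)).
  rewrite -[leLHS](@big_add1 _ _ _ 0 n.+1 xpredT
    (fun i => K2 * (i%:R * (level i)%:R ^+ 2)^-1)).
  apply: le_trans (hM n.+1).
  apply: (@sum_le_dyadic _ _ (fun j => K2 * (j.+1%:R ^+ 2)^-1)).
    by move=> t; rewrite mulr_ge0// invr_ge0 mulr_ge0.
  move=> j; rewrite -mulr_sumr ler_wpM2l//.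
  apply: (@le_trans _ _ (\sum_(2 ^ j <= t < 2 ^ j.+1) (j.+1%:R ^+ 2)^-1 * t%:R^-1)).
    rewrite big_nat_cond [leRHS]big_nat_cond; apply: ler_sum => t /andP[tj _].
    by rewrite (level_block tj) invfM mulrC.
  by rewrite -mulr_sumr ler_piMr ?sum_inv_block// invr_ge0 sqr_ge0.
Qed.

End moments.

(** * The kernel sums on the circle *)

Section circle.
Context (R : realType).
Implicit Types (x y theta : R) (z : R[i]).

Lemma expiD x y : expi (x + y) = expi x * expi y.
Proof.
by rewrite /expi cosD sinD; apply/eqP; rewrite eq_complex /= addrC eqxx/= addrC eqxx.
Qed.

Lemma expi0 : expi 0 = 1 :> R[i].
Proof. by rewrite /expi cos0 sin0. Qed.

Lemma expiNK x : expi x * expi (- x) = 1 :> R[i].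
Proof. by rewrite -expiD subrr expi0. Qed.

Lemma expiMn x n : expi (x * n%:R) = expi x ^+ n.
Proof.
elim: n => [|n ih]; first by rewrite mulr0 expr0 expi0.
by rewrite -natr1 mulrDr mulr1 expiD ih exprSr.
Qed.

Lemma normc_expi x : normc (expi x) = 1.
Proof. by rewrite /expi /= cos2Dsin2 sqrtr1. Qed.

Lemma normc_expiB x y : normc (expi x - expi y) = normc (1 - expi (y - x)).
Proof.
have -> : expi x - expi y = expi x * (1 - expi (y - x)).
  by rewrite mulrBr mulr1 -expiD [x + _]addrC subrK.
by rewrite normcM normc_expi mul1r.
Qed.

Lemma expi_inj_range x y : - pi <= x < pi -> - pi <= y < pi ->
  expi x = expi y -> x = y.
Proof.
suff H (u v : R) : - pi <= u < pi -> - pi <= v < pi -> u < v -> expi u = expi v -> False.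
  move=> hx hy e; have [xy|yx|//] := ltgtP x y.
    by case: (H _ _ hx hy xy e).
  by case: (H _ _ hy hx yx (esym e)).
move=> /andP[u1 u2] /andP[v1 v2] uv e.
have : expi (v - u) = 1 :> R[i] by rewrite expiD -e expiNK.
move=> [c1 _]; have s0 : 0 < sin ((v - u) / 2).
  by apply: sin_gt0_pi; rewrite divr_gt0 ?subr_gt0//= ltr_pdivrMr//; lra.
have := cos2Dsin2 ((v - u) / 2).
move: c1; rewrite -{1}[v - u](@divfK _ 2)// mulr_natr cos_mulr2n => c1.
have : 0 < sin ((v - u) / 2) ^+ 2 by rewrite exprn_gt0.
by move: c1; rewrite -mulr_natr; lra.
Qed.

End circle.

Section summation_by_parts.
Context (R : realType).

(** Summation by parts: up to the boundary term c_m V_m, the sum is a sum of the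
    partial sums V_t with the nonnegative weights c_t - c_(t+1). *)
Lemma abel_bound (c : nat -> R) (v : nat -> R[i]) (B : R) m :
  (forall t, (1 <= t)%N -> 0 <= c t) ->
  (forall t, (1 <= t)%N -> c t.+1 <= c t) ->
  (forall k, normc (\sum_(1 <= t < k.+1) v t) <= B) ->
  normc (\sum_(1 <= t < m.+1) (c t)%:C%C * v t) <= c 1%N * B.
Proof.
move=> c0 cd vB; have B0 : 0 <= B.
  by have := vB 0%N; rewrite big_geq// normc0.
case: m => [|m]; first by rewrite big_geq// normc0 mulr_ge0 ?c0.
pose V k := \sum_(1 <= t < k.+1) v t.
have h : normc (\sum_(1 <= t < m.+2) (c t)%:C%C * v t - (c m.+1)%:C%C * V m.+1) <=
    (c 1%N - c m.+1) * B.
  elim: m => [|m ih].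
    by rewrite /V !big_nat1 !subrr normc0 mul0r.
  rewrite (_ : _ - _ = (\sum_(1 <= t < m.+2) (c t)%:C%C * v t - (c m.+1)%:C%C * V m.+1) +
      (c m.+1 - c m.+2)%:C%C * V m.+1).
    rewrite (le_trans (le_normcD _ _))// normcM normc_real ger0_norm ?subr_ge0 ?cd//.
    have := ler_wpM2l _ (vB m.+1) => /(_ (c m.+1 - c m.+2)).
    rewrite subr_ge0 cd// => /(_ isT).
    by move: ih; rewrite -/(V _); lra.
  rewrite [LHS]addrC big_nat_recr//= {1}/V [in X in _ * X]big_nat_recr//= -/(V m.+1).
  by rewrite rmorphB/=; ring.
rewrite -[X in normc X](subrK ((c m.+1)%:C%C * V m.+1)).
apply: (le_trans (le_normcD _ _)).
rewrite normcM normc_real ger0_norm ?c0//.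
have := ler_wpM2l (c0 m.+1 isT) (vB m.+1); move: h; rewrite -/(V _); lra.
Qed.

Lemma geometric_bound (z : R[i]) k : normc z = 1 ->
  normc (\sum_(1 <= t < k.+1) z ^+ t) * normc (1 - z) <= 2.
Proof.
move=> z1; rewrite -normcM.
have -> : (\sum_(1 <= t < k.+1) z ^+ t) * (1 - z) = z - z ^+ k.+1.
  elim: k => [|k ih]; first by rewrite big_geq// mul0r expr1 subrr.
  by rewrite big_nat_recr//= mulrDl ih; rewrite !exprS; ring.
rewrite (le_trans (le_normcD _ _))// normcN normcX z1 expr1n; lra.
Qed.

Context (a : nat -> nat -> R) (a_summation : summation_matrix a).

Let a_ge0 m t : (1 <= m)%N -> (1 <= t)%N -> 0 <= a m t.
Proof.
have [_ [_ [h [h0 _]]]] := a_summation => m1 t1.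
by have [tm|tm] := leqP t m; [exact: h|rewrite h0].
Qed.

Let a_noninc m t : (1 <= m)%N -> (1 <= t)%N -> a m t.+1 <= a m t.
Proof. by have [_ [h _]] := a_summation => m1 t1; exact: h. Qed.

Let a_le1 m : (1 <= m)%N -> a m 1%N <= 1.
Proof. by have [h _] := a_summation => /h/andP[]. Qed.

Lemma SA_bounded (u : nat -> R[i]) (B : R) (z : R[i]) m : (1 <= m)%N ->
  (forall k, normc (\sum_(1 <= t < k.+1) u t / t%:R * z ^+ t) <= B) ->
  normc (SA a u m z) <= B.
Proof.
move=> m1 uB; have B0 : 0 <= B by have := uB 0%N; rewrite big_geq// normc0.
rewrite /SA; under eq_bigr do rewrite -mulrA.
apply: (le_trans (abel_bound m _ _ uB)).
- by move=> t t1; exact: a_ge0.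
- by move=> t t1; exact: a_noninc.
- by rewrite ler_piMl ?a_le1.
Qed.

(** The weights a m t / t are still non-increasing, and the geometric sums are
    bounded by 2 / |1 - z|. *)
Lemma SA_ones_decay (z : R[i]) m : (1 <= m)%N -> normc z = 1 ->
  normc (SA a (@ones R) m z) * normc (1 - z) <= 2.
Proof.
move=> m1 z1; have [z0|z0] := eqVneq (normc (1 - z)) 0; first by rewrite z0 mulr0.
have zp : 0 < normc (1 - z) by rewrite lt_neqAle eq_sym z0 normc_ge0.
rewrite -ler_pdivlMr// /SA.
rewrite (eq_bigr (fun t => ((a m t / t%:R)%:C)%C * z ^+ t)); last first.
  by move=> t _; rewrite /ones div1r rmorphM fmorphV rmorph_nat.
apply: (le_trans (@abel_bound (fun t => a m t / t%:R) _ (2 / normc (1 - z)) _ _ _ _)).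
- by move=> t t1; rewrite divr_ge0// a_ge0.
- move=> t t1; rewrite ler_pM ?a_ge0 ?invr_ge0 ?a_noninc//.
  by rewrite lef_pV2 ?posrE ?ltr0n// ler_nat.
- by move=> k; rewrite ler_pdivlMr// geometric_bound.
- by rewrite divr1 ler_piMl ?a_le1// divr_ge0// normc_ge0.
Qed.

End summation_by_parts.

(** * Superlevel arcs of a signal with bounded noise *)

Section localisation.
Context (R : realType) (N : nat) (alpha : 'I_N -> R[i]) (lambda : 'I_N -> R).
Context (a : nat -> nat -> R) (a_summation : summation_matrix a).
Context (noise : nat -> R[i]) (B : R).
Hypothesis noise_bounded : forall z m, normc z <= 1 ->
  normc (\sum_(1 <= t < m.+1) noise t / t%:R * z ^+ t) <= B.

Let x t := signal alpha lambda t + noise t.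
Let S1 := SA a (@ones R).
Let A := \sum_(n < N) normc (alpha n).

(** Each frequency rotates the kernel to its atom. *)
Lemma SA_observed m z : SA a x m z =
  \sum_(n < N) alpha n * S1 m (z * expi (- lambda n)) + SA a noise m z.
Proof.
rewrite /SA /S1 /SA; under [X in _ = X + _]eq_bigr do rewrite mulr_sumr.
rewrite exchange_big/= -big_split/=; apply: eq_bigr => t _.
rewrite /x /signal /ones mulrDl mulrDr mulrDl; congr (_ + _).
rewrite mulr_suml mulr_sumr mulr_suml; apply: eq_bigr => n _.
by rewrite -mulNr expiMn exprMn; ring.
Qed.

Let S1_far m z n dl : (1 <= m)%N -> normc z = 1 -> 0 < dl ->
  dl <= normc (z - expi (lambda n)) ->
  normc (alpha n * S1 m (z * expi (- lambda n))) <= normc (alpha n) * (2 / dl).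
Proof.
move=> m1 z1 dl0 h; rewrite normcM ler_wpM2l ?normc_ge0//.
have e : normc (1 - z * expi (- lambda n)) = normc (z - expi (lambda n)).
  rewrite normcB.
  have -> : z * expi (- lambda n) - 1 =
      (z - expi (lambda n)) * expi (- lambda n).
    by rewrite mulrBl expiNK.
  by rewrite normcM normc_expi mulr1.
have := @SA_ones_decay _ _ a_summation (z * expi (- lambda n)) m m1.
rewrite normcM z1 normc_expi mulr1 e => /(_ erefl) h2.
rewrite ler_pdivlMr//; apply: le_trans h2.
by rewrite ler_wpM2l ?normc_ge0.
Qed.

Let noise_SA m z : (1 <= m)%N -> normc z = 1 -> normc (SA a noise m z) <= B.
Proof.
by move=> m1 z1; apply: SA_bounded => // k; apply: noise_bounded; rewrite z1.
Qed.

Lemma SA_far m z dl : (1 <= m)%N -> normc z = 1 -> 0 < dl ->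
  (forall n, dl <= normc (z - expi (lambda n))) ->
  normc (SA a x m z) <= A * (2 / dl) + B.
Proof.
move=> m1 z1 dl0 far; rewrite SA_observed (le_trans (le_normcD _ _))// lerD ?noise_SA//.
rewrite (le_trans (normc_sum _ _ _))// /A mulr_suml ler_sum// => n _.
exact: S1_far.
Qed.

Lemma SA_near m z n dl : (1 <= m)%N -> normc z = 1 -> 0 < dl ->
  (forall k, k != n -> dl <= normc (z - expi (lambda k))) ->
  normc (alpha n) * normc (S1 m (z * expi (- lambda n))) - (A * (2 / dl) + B) <=
  normc (SA a x m z).
Proof.
move=> m1 z1 dl0 far; rewrite SA_observed (bigD1 n)//= -addrA -normcM.
set p := alpha n * _; set q := (X in normc (p + X)).
have : normc p - normc q <= normc (p + q).
  by have := ler_normcB p (- q); rewrite normcN opprK.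
have : normc q <= A * (2 / dl) + B.
  rewrite /q (le_trans (le_normcD _ _))// lerD ?noise_SA//.
  rewrite (le_trans (normc_sum _ _ _))// /A mulr_suml [leRHS](bigD1 n)//=.
  apply: ler_wpDl; first by rewrite mulr_ge0 ?normc_ge0// divr_ge0// ltW.
  by apply: ler_sum => k kn; apply: S1_far => //; exact: far.
lra.
Qed.

Context (H h : nat -> R) (J : nat -> nat).
Hypothesis J_gt0 : forall m, (1 <= m)%N -> (0 < J m)%N.
Hypothesis J_peak : forall m, (1 <= m)%N ->
  forall theta : R, - (2 * pi / (J m)%:R) <= theta <= 2 * pi / (J m)%:R ->
    H m <= normc (S1 m (expi theta)).

(** H_m <= |kernel| <= 2 / |1 - z| at every z within one step of 1. *)
Lemma mesh m theta : (1 <= m)%N -> 0 < H m ->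
  - (2 * pi / (J m)%:R) <= theta <= 2 * pi / (J m)%:R ->
  normc (1 - expi theta) <= 2 / H m.
Proof.
move=> m1 H0 th; rewrite ler_pdivlMr//.
apply: le_trans (SA_ones_decay a_summation m1 (normc_expi theta)).
by rewrite mulrC ler_wpM2r ?normc_ge0// J_peak.
Qed.

Let step m := 2 * pi / (J m)%:R : R.

Let step_gt0 m : (1 <= m)%N -> 0 < step m.
Proof.
by move=> m1; rewrite /step divr_gt0 ?mulr_gt0 ?pi_gt0// ltr0n J_gt0.
Qed.

Let gridE m (j : int) : grid R (J m) j = step m * j%:~R.
Proof. by rewrite /grid /step mulrAC. Qed.

Let grid_floor m theta : (1 <= m)%N ->
  grid R (J m) (Num.floor (theta / step m)) <= theta <
  grid R (J m) (Num.floor (theta / step m) + 1).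
Proof.
move=> m1; rewrite !gridE; have := floor_itv (theta / step m).
by rewrite ler_pdivlMr ?step_gt0// ltr_pdivrMr ?step_gt0// ![step m * _]mulrC.
Qed.

Let L m := superlevel_arcs_union a x m (h m) (J m).

(** A point of an arc lies within one step of a grid point of the same arc, and
    by [SA_far] that grid point is close to an atom. *)
Lemma arcs_near_atoms m dl zeta : (1 <= m)%N -> 0 < H m -> 0 < dl ->
  A * (2 / dl) + B < h m -> L m zeta ->
  exists n, normc (zeta - expi (lambda n)) <= dl + 2 / H m.
Proof.
move=> m1 H0 dl0 hm [K [j1 [j2 [j12 [big ->]]]]] [theta th <-].
have /andP[th1 th2] : grid R (J m) j1 <= theta <= grid R (J m) j2.
  by move: th; rewrite /= in_itv.
set j := Num.floor (theta / step m).
have /andP[jt tj] := grid_floor theta m1.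
have s0 := step_gt0 m1.
have j1j : j1 <= j.
  by rewrite -ltzD1 -(ltr_int R) -(ltr_pM2l s0) -!gridE (le_lt_trans th1).
have jj2 : j <= j2.
  by rewrite -(ler_int R) -(ler_pM2l s0) -!gridE (le_trans jt).
have hj := big j; rewrite j1j jj2 in hj; have {}hj := hj isT.
have [n near] : exists n, normc (expi (grid R (J m) j) - expi (lambda n)) < dl.
  apply: contrapT => far; move: hj; apply/negP; rewrite -ltNge.
  apply: le_lt_trans hm; apply: SA_far => // [|n]; first exact: normc_expi.
  by rewrite leNgt; apply/negP => lt; apply: far; exists n.
exists n.
rewrite -[expi theta](subrK (expi (grid R (J m) j))) -addrA addrC.
rewrite (le_trans (le_normcD _ _))// lerD ?(ltW near)//.
rewrite normcB normc_expiB; apply: mesh => //.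
move: jt tj; rewrite !gridE -/j rmorphD/= mulrDr mulr1 -/(step m) => jt tj.
by have := s0; lra.
Qed.

(** The two grid points on either side of the atom form an arc: both are within
    one step of the atom, where its kernel is at least H_m, and away from the
    other atoms. *)
Lemma atom_in_arcs m n dl : (1 <= m)%N -> 0 < H m -> 0 < dl ->
  (forall k, k != n -> 2 * dl <= normc (expi (lambda k) - expi (lambda n))) ->
  2 / H m <= dl -> h m <= normc (alpha n) * H m - (A * (2 / dl) + B) ->
  L m (expi (lambda n)).
Proof.
move=> m1 H0 dl0 sep Hdl hm.
set j := Num.floor (lambda n / step m).
have /andP[jt tj] := grid_floor (lambda n) m1.
have s0 := step_gt0 m1.
exists (Arc (grid R (J m) j) (grid R (J m) (j + 1))); last first.
  by exists (lambda n) => //=; rewrite in_itv/= jt ltW.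
exists j, (j + 1); split; first by rewrite lerDl.
split => // i /andP[ji ij]; apply: (le_trans hm).
have th : - (step m) <= grid R (J m) i - lambda n <= step m.
  have : grid R (J m) j <= grid R (J m) i by rewrite !gridE ler_pM2l// ler_int.
  have : grid R (J m) i <= grid R (J m) (j + 1) by rewrite !gridE ler_pM2l// ler_int.
  move: jt tj; rewrite -/j (gridE m (j + 1)) rmorphD/= mulrDr mulr1 -gridE => jt tj.
  by lra.
apply: le_trans (@SA_near m _ n dl m1 (normc_expi _) dl0 _).
  by rewrite lerD2r ler_wpM2l ?normc_ge0// -expiD J_peak.
move=> k kn; have := sep k kn.
have : normc (expi (grid R (J m) i) - expi (lambda n)) <= dl.
  apply: le_trans Hdl; rewrite normcB normc_expiB; exact: mesh.
have : normc (expi (lambda k) - expi (lambda n)) <=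
  normc (expi (lambda k) - expi (grid R (J m) i)) +
  normc (expi (grid R (J m) i) - expi (lambda n)).
  by rewrite (le_trans _ (le_normcD _ _))// addrA subrK.
rewrite (normcB (expi (grid _ _ _)) (expi (lambda k))); lra.
Qed.

End localisation.

(** * Convergence of sets and the support of the spectral measure *)

Section set_limits.
Context (R : realType).
Implicit Types (G L : set (R[i])).

Lemma dist_ge0 (z : R[i]) G : (0 <= dist z G)%E.
Proof. by apply/ereal_infP => _ [g _ <-]; rewrite lee_fin normc_ge0. Qed.

Lemma dist_le (z g : R[i]) G : G g -> (dist z G <= (normc (z - g))%:E)%E.
Proof. by move=> Gg; apply: ereal_inf_lbound; exists g. Qed.

Lemma dist_fin_num (z : R[i]) G : G !=set0 -> dist z G \is a fin_num.
Proof.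
move=> [g Gg]; rewrite ge0_fin_numE ?dist_ge0//.
exact: le_lt_trans (dist_le z Gg) (ltry _).
Qed.

Lemma dist_PH_le L G (r : R) : 0 <= r -> G `<=` L ->
  (forall z, L z -> exists2 g, G g & normc (z - g) <= r) ->
  (0 <= dist_PH L G <= r%:E)%E.
Proof.
move=> r0 GL Lr; rewrite /dist_PH (setUidl GL).
have [_|/set0P[l Ll]] := eqVneq L set0; first by rewrite lexx lee_fin.
have [g0 Gg0 _] := Lr l Ll.
have Gn : G !=set0 by exists g0.
have Ln : L !=set0 by exists l.
apply/andP; split.
  apply: le_trans (ereal_sup_ubound _); last by exists 0.
  exact: abse_ge0.
apply/ereal_supP => _ [z _ <-].
have d1 : (dist z L <= dist z G)%E.
  by apply/ereal_infP => _ [g Gg <-]; apply: dist_le; exact: GL.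
have d2 : (dist z G <= dist z L + r%:E)%E.
  rewrite -leeBlDr//; apply/ereal_infP => _ [u Lu <-].
  have [g Gg ug] := Lr u Lu; rewrite leeBlDr// -EFinD.
  apply: le_trans (dist_le z Gg) _; rewrite lee_fin.
  have -> : z - g = (z - u) + (u - g) by rewrite addrA subrK.
  by rewrite (le_trans (le_normcD _ _))// lerD2l.
rewrite -(fineK (dist_fin_num z Gn)) -(fineK (dist_fin_num z Ln)) in d1 d2 *.
move: d1 d2; rewrite -EFinD -EFinB abse_EFin !lee_fin => d1 d2.
by rewrite ler_norml; apply/andP; split; lra.
Qed.

(** When L m contains G, only the distance from points of L m to G matters.  For
    G empty the hypothesis forces L m to be empty as well. *)
Lemma set_converges_superset (L : nat -> set R[i]) G :
  (forall r, 0 < r -> \forall m \near \oo, G `<=` L m /\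
    (forall z, L m z -> exists2 g, G g & normc (z - g) <= r)) ->
  set_converges L G.
Proof.
move=> h; apply/fine_cvgP; split.
  have := h 1 ltr01; apply: filterS => m [h1 h2].
  have /andP[d0 d1] := dist_PH_le ler01 h1 h2.
  by rewrite ge0_fin_numE// (le_lt_trans d1) ?ltry.
apply/cvgrPdist_le => r r0; have := h r r0; apply: filterS => m [h1 h2].
have /andP[d0 d1] := dist_PH_le (ltW r0) h1 h2.
have dfin : dist_PH (L m) G \is a fin_num.
  by rewrite ge0_fin_numE// (le_lt_trans d1) ?ltry.
rewrite /= sub0r normrN ger0_norm ?fine_ge0//.
by rewrite -lee_fin fineK.
Qed.

End set_limits.

Section support.
Context (R : realType) (N : nat) (alpha : 'I_N -> R[i]) (lambda : 'I_N -> R).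
Hypothesis alpha_neq0 : forall n, alpha n != 0.
Hypothesis lambda_range : forall n, - pi <= lambda n < pi.
Hypothesis lambda_distinct : injective lambda.

Lemma atoms_distinct n k : expi (lambda n) = expi (lambda k) -> n = k.
Proof. by move=> /expi_inj_range h; apply: lambda_distinct; exact: h. Qed.

Lemma atoms_separated : exists2 dl : R, 0 < dl &
  forall n k, k != n -> 2 * dl <= normc (expi (lambda k) - expi (lambda n)).
Proof.
pose D (p : 'I_N * 'I_N) :=
  if p.1 == p.2 then 1 else normc (expi (lambda p.1) - expi (lambda p.2)).
have D0 p : 0 < D p.
  rewrite /D; case: eqVneq => // ne; rewrite lt_neqAle normc_ge0 andbT eq_sym.
  apply: contra ne => /eqP/eq0_normc/eqP; rewrite subr_eq0 => /eqP/atoms_distinct ->.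
  exact: eqxx.
exists (2^-1 * \big[Num.min/1]_p D p).
  by rewrite mulr_gt0// lt_bigmin// => p _; exact: D0.
move=> n k kn; rewrite mulrA divff// mul1r.
have : \big[Num.min/1]_p D p <= D (k, n) by exact: bigmin_le_cond.
by rewrite /D /= (negbTE kn).
Qed.

Lemma measurable_set1C (z : R[i]) : measurable [set z].
Proof.
suff : measurable (@complex_of_pair R @^-1` [set z]) by [].
rewrite (_ : _ @^-1` _ = [set complex.Re z] `*` [set complex.Im z]).
  by apply: measurableX; exact: measurable_set1.
apply/seteqP; split=> [[p q] /= <-//|[p q] /= [-> ->]].
by rewrite /complex_of_pair /=; case: z.
Qed.

(** Distinct frequencies in a half-open period give distinct atoms, so that
    masses cannot cancel. *)
Lemma supp_spectral_measure :
  supp (spectral_measure alpha lambda) = [set expi (lambda n) | n in [set: 'I_N]].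
Proof.
apply/seteqP; split => [z sz|_ [n _ <-] r r0].
  apply: contrapT => nz.
  pose r := \big[Num.min/1]_n normc (expi (lambda n) - z).
  have r0 : 0 < r.
    rewrite lt_bigmin// => n _; rewrite lt_neqAle normc_ge0 andbT eq_sym.
    apply/negP => /eqP/eq0_normc/eqP; rewrite subr_eq0 => /eqP e.
    by apply: nz; exists n.
  have [E [_ [Er /eqP]]] := sz r r0; apply; rewrite /spectral_measure big1// => n _.
  rewrite indicE memNset ?mulr0// => /Er /=; apply/negP; rewrite -leNgt.
  exact: bigmin_le_cond.
exists [set expi (lambda n)]; split; first exact: measurable_set1C.
split; first by move=> _ ->; rewrite /mkset subrr normc0.
rewrite /spectral_measure (bigD1 n)//= big1 ?addr0.
  by rewrite indicE mem_set// mulr1.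
move=> k kn; rewrite indicE memNset ?mulr0// => /atoms_distinct e.
by rewrite e eqxx in kn.
Qed.

End support.

(** * Almost sure recovery of the support *)

Theorem theorem3p2 (R : realType) (d : measure_display) (Omega : measurableType d)
  (P : probability Omega R) (P_complete : measure_is_complete P)
  (eps : nat -> {RV P >-> R[i]}) (eps_indep : mutually_independent eps)
  (N : nat) (alpha : 'I_N -> R[i]) (lambda : 'I_N -> R)
  (alpha_neq0 : forall n, alpha n != 0)
  (lambda_range : forall n, - pi <= lambda n < pi)
  (lambda_distinct : injective lambda)
  (a : nat -> nat -> R) (a_summation : summation_matrix a)
  (H h : nat -> R) (J : nat -> nat)
  (H_lt : forall m, (1 <= m)%N -> H m < complex.Re (SA a (@ones R) m 1))
  (H_lim : H m @[m --> \oo] --> +oo)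
  (h_lim : h m @[m --> \oo] --> +oo)
  (Hh_lim : H m / h m @[m --> \oo] --> +oo)
  (J_gt0 : forall m, (1 <= m)%N -> (0 < J m)%N)
  (J_peak : forall m, (1 <= m)%N ->
     forall theta : R, - (2 * pi / (J m)%:R) <= theta <= 2 * pi / (J m)%:R ->
       H m <= normc (SA a (@ones R) m (expi theta)))
  (noise : noise_N1 eps \/ noise_N2 eps \/ noise_N3 eps) :
  let x w t := signal alpha lambda t + eps t w in
  let L w m := superlevel_arcs_union a (x w) m (h m) (J m) in
  let mu := spectral_measure alpha lambda in
  {ae P, forall w : Omega,
    set_converges (L w) (supp mu) /\
    \forall m \near \oo, supp mu `<=` L w m}.
Proof.
move=> x L mu.
have eps_tame : tame eps.
  case: noise => [|[]]; [exact: noise_N1_tame|exact: noise_N2_tame|exact: noise_N3_tame].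
have := ae_noise_bounded eps_indep eps_tame; apply: filterS => w [B hB].
have noiseB z m : normc z <= 1 ->
    normc (\sum_(1 <= t < m.+1) eps t w / t%:R * z ^+ t) <= B by move=> z1; exact: hB.
rewrite /mu supp_spectral_measure//.
move/cvgryPgt in H_lim; move/cvgryPgt in h_lim; move/cvgryPge in Hh_lim.
have [dl dl0 sep] := atoms_separated lambda_range lambda_distinct.
pose A := \sum_(n < N) normc (alpha n).
have atoms_in : \forall m \near \oo, [set expi (lambda n) | n in [set: 'I_N]] `<=` L w m.
  have each n : \forall m \near \oo, L w m (expi (lambda n)).
    have an0 : 0 < normc (alpha n).
      rewrite lt_neqAle normc_ge0 andbT eq_sym.
      by apply: contra (alpha_neq0 n) => /eqP/eq0_normc ->.
    near=> m.
    have m1 : (1 <= m)%N by near: m; exact: nbhs_infty_gt.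
    have H0 : 0 < H m by near: m; exact: H_lim.
    have Hdl : 2 / dl < H m by near: m; exact: H_lim.
    have hM : Num.max 0 (A * (2 / dl) + B) < h m by near: m; exact: h_lim.
    have Hh : 2 / normc (alpha n) <= H m / h m by near: m; exact: Hh_lim.
    move: hM; rewrite gt_max => /andP[h0 hM].
    apply: (atom_in_arcs a_summation noiseB J_gt0 J_peak (dl := dl)) => //.
    - by move=> k kn; exact: sep.
    - by move: Hdl; rewrite ltr_pdivrMr// => Hdl; rewrite ler_pdivrMr// mulrC ltW.
    (* |alpha_n| H_m >= 2 h_m: one half absorbs the constant, the other is h_m. *)
    move: Hh; rewrite ler_pdivlMr// mulrAC ler_pdivrMr// [H m * _]mulrC => Hh.
    by rewrite -/A; lra.
  have : \forall m \near \oo, forall n, L w m (expi (lambda n)) by exact: filter_forall.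
  by apply: filterS => m hm _ [n _ <-].
split => //; apply: set_converges_superset => r r0.
near=> m; split; first by near: m; exact: atoms_in.
have m1 : (1 <= m)%N by near: m; exact: nbhs_infty_gt.
have H0 : 0 < H m by near: m; exact: H_lim.
(* Half of r for the distance from a grid point to an atom, half for the mesh. *)
have Hr : 4 / r < H m by near: m; exact: H_lim.
have hM : A * (2 / (r / 2)) + B < h m by near: m; exact: h_lim.
move=> z Lz; have r20 : 0 < r / 2 by rewrite divr_gt0.
have [n zn] := arcs_near_atoms a_summation noiseB J_gt0 J_peak m1 H0 r20 hM Lz.
exists (expi (lambda n)); first by exists n.
apply: (le_trans zn); have : 2 / H m <= r / 2.
  move: Hr; rewrite ltr_pdivrMr// => Hr.
  by rewrite ler_pdivrMr//; lra.
by lra.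
Unshelve. all: by end_near. Qed.
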